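(* Let $\mathcal{A}\in\mathfrak{H}$ multiply two integers $A,B$, each represented with $n$ base-$s$ digits, using $P$ processors each equipped with an unbounded local memory. Assume that at the beginning of the execution no processor holds more than $\alpha n/P$ digits of each input integer in its local memory, where $\alpha\in[1,P]$, and that each I/O operation (message) moves up to $B_m$ memory words. Then in every execution of $\mathcal{A}$ some processor sends or receives $$\Omega\!\left(\frac{\max_{n'\in\{\alpha n/P,\dots,n\}} n'\min\left\{\frac14,\ \sqrt{\frac{\nu_1(n')}{8P}}+\frac{\nu(n')}{2P}\right\}-\frac{\alpha n}{P}}{B_m}\right)$$ messages, where $\nu_1(n')$ is the number of Type 1 $n'$-MSPs and $\nu(n')$ the total number of $n'$-MSPs generated by $\mathcal{A}$.
   Context: Integers are written in base $s\ge2$, one digit per memory word; $A=(A[n-1],\dots,A[0])_s$; size = number of digits. Computations are viewed as computational DAGs (vertices: input digits or results of unit-time operations; edges: data dependencies). Standard class: an algorithm multiplying $m$-digit $A,B$ is standard if it directly computes all $m^2$ elementary products $A[i]B[j]$; each digit $C[i]$ of $C=AB$ is computed by summing the products $A[j]B[k]$ with $j+k=i$ through a summation tree of additions and subtractions only, plus any carry; and internal vertex sets of the summation trees of distinct $C[i]$ are disjoint. Toom-$k$ step ($k\ge2$ integer) on $m$-digit $A,B$: split each into $k$ blocks of $\lceil m/k\rceil$ consecutive digits, form degree-$(k-1)$ polynomials $p,q$ with these blocks as coefficients ($p(s^{\lceil m/k\rceil})=A$, $q(s^{\lceil m/k\rceil})=B$), evaluate at $2k-1$ distinct points, recursively compute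 the $2k-1$ products (sub-problems), interpolate $r=pq$ via the inverse Vandermonde matrix, recompose $C=\sum_ir_is^{i\lceil m/k\rceil}$. Class $\mathfrak{H}$: algorithms given by an instruction function that for each (sub)problem prescribes either a standard algorithm, or a $k\ge2$ such that the (sub)problem is computed by a Toom-$k$ step together with instruction functions for its $2k-1$ sub-problems; whenever Toom-$k$ is applied to a (sub)problem of size $m$, each sub-problem has size at most $2m/k<m$. Sub-problems of equal size may be treated differently. Maximal sub-problems: the whole problem is an (improper) sub-problem; ancestors of a sub-problem are those in the chain of recursive calls generating it. For $n'\in\mathbb{N}^+$: if $n<n'$ there is no $n'$-MSP; otherwise a sub-problem of input size $\ge n'$ all of whose ancestors are computed by Toom-Cook steps is a Type 1 $n'$-MSP if computed by a standard algorithm, and a Type 2 $n'$-MSP if computed by a Toom-$k$ step all of whose sub-problems have input size $<n'$. $\nu(n')=\nu_1(n')+\nu_2(n')$. Parallel model: processors with local (non-shared) memories, exchanging point-to-point messages; a processor operates only on values in its local memory; recomputation allowed. *)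

(* Defs.v *)
(* MathComp world; real numbers range over a MathComp-Analysis realType. *)
From HB Require Import structures.
From mathcomp Require Import all_boot all_order all_algebra.
From mathcomp Require Import reals.

Set Implicit Arguments.
Unset Strict Implicit.
Unset Printing Implicit Defensive.

Import Order.TTheory GRing.Theory Num.Theory.
Local Open Scope ring_scope.

(* The number of sub-problems of a Toom-k step. *)
Notation toom_branches k := (k.*2.-1).

(* [ToomCook k pt sz sub] evaluates at the points [pt j] and solves the j-th
   sub-problem, of size [sz j], as prescribed by [sub j]. *)
Inductive instruction : Type :=
| Standard
| ToomCook (k : nat) (pt : 'I_(toom_branches k) -> int)
    (sz : 'I_(toom_branches k) -> nat)
    (sub : 'I_(toom_branches k) -> instruction).

(* The size condition "at most 2m/k < m" is read as "at most 2m/k, and less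
   than m": for k = 2 the chain itself could never hold. *)
Fixpoint class_H (f : instruction) (m : nat) : Prop :=
  match f with
  | Standard => True
  | ToomCook k pt sz sub =>
      [/\ (2 <= k)%N, injective pt,
          forall j, (sz j * k <= 2 * m)%N /\ (sz j < m)%N
        & forall j, class_H (sub j) (sz j)]
  end.

(* Numbers of maximal sub-problems of either type when [f] runs on a problem
   of size [m].  Only standard algorithms end the recursion, so all ancestors
   of a sub-problem are Toom-Cook steps. *)
Fixpoint nu1 (n' : nat) (f : instruction) (m : nat) : nat :=
  match f with
  | Standard => (n' <= m)%N
  | ToomCook k pt sz sub => (\sum_j nu1 n' (sub j) (sz j))%N
  end.

Fixpoint nu2 (n' : nat) (f : instruction) (m : nat) : nat :=
  match f with
  | Standard => 0%N
  | ToomCook k pt sz sub =>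
      (((n' <= m) && [forall j, sz j < n']) +
       \sum_j nu2 n' (sub j) (sz j))%N
  end.

Definition nu (n' : nat) (f : instruction) (m : nat) : nat :=
  (nu1 n' f m + nu2 n' f m)%N.

(* A computational DAG on two n-digit inputs.  Gates are the non-input
   vertices; [operands g] lists the operands of [g], [op g] is its operation and
   [gate_words g] is the number of memory words that its result occupies. *)
Record cdag (n : nat) := CDAG {
  gate : finType;
  operands : gate -> seq (('I_n + 'I_n) + gate)%type;
  op : gate -> seq int -> int;
  gate_words : gate -> nat;
  level : gate -> nat
}.

Section Dag.
Variables (s n : nat) (G : cdag n).

(* [inl (inl i)] is A[i], [inl (inr i)] is B[i]. *)
Definition vertex : finType := (('I_n + 'I_n) + gate G)%type.

Definition gate_vertex (g : gate G) : vertex := inr g.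

Definition inputs := (('I_n -> 'I_s) * ('I_n -> 'I_s))%type.

Definition words (v : vertex) : nat :=
  match v with inl _ => 1%N | inr g => gate_words g end.

(* [d] is recursion fuel; [(level g).+1] suffices for gate [g]. *)
Fixpoint eval (d : nat) (x : inputs) (v : vertex) : int :=
  match v with
  | inl (inl i) => (x.1 i : nat)%:Z
  | inl (inr i) => (x.2 i : nat)%:Z
  | inr g => if d is d'.+1 then op g [seq eval d' x u | u <- operands g] else 0
  end.

Definition value (x : inputs) (v : vertex) : int :=
  match v with inl _ => eval 0 x v | inr g => eval (level g).+1 x v end.

(* One base-s digit per memory word: a result kept in w words has a magnitude
   of at most w digits (its sign is not charged for). *)
Definition cdag_wf : Prop :=
  (forall g h : gate G,
     gate_vertex h \in operands g -> (level h < level g)%N) /\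
  (forall g : gate G, (0 < gate_words g)%N /\
     forall x, `|value x (gate_vertex g)| < (s ^ gate_words g)%N%:Z).

Definition digit_vertex (v : vertex) : Prop :=
  words v = 1%N /\ forall x, 0 <= value x v < s%:Z.

(* Base-s integers, least significant digit first. *)
Definition num (x : inputs) (a : seq vertex) : int :=
  foldr (fun v acc => value x v + s%:Z * acc) 0 a.

(* p with p(s ^ h) = a, whose k coefficients are the h-digit blocks of a. *)
Definition block_poly (x : inputs) (k h : nat) (a : seq vertex) : {poly int} :=
  \poly_(e < k) num x (take h (drop (e * h) a)).

Definition reads_only (E : seq (gate G)) (X : seq vertex) : Prop :=
  forall g, g \in E -> {subset operands g <= X ++ map gate_vertex E}.

(* An inner node of a summation tree adds its subtrees, or subtracts the right
   one from the left one when [neg] is true. *)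
Inductive sumtree : Type :=
| Leaf (g : gate G)
| Node (g : gate G) (neg : bool) (l r : sumtree).

Definition root (t : sumtree) : gate G :=
  match t with Leaf g => g | Node g _ _ _ => g end.

Fixpoint inner (t : sumtree) : seq (gate G) :=
  match t with Leaf _ => [::] | Node g _ l r => g :: inner l ++ inner r end.

(* The leaves, each with the sign (true is minus) of its contribution. *)
Fixpoint terms (t : sumtree) : seq (bool * gate G) :=
  match t with
  | Leaf g => [:: (false, g)]
  | Node _ neg l r => terms l ++ [seq (neg (+) u.1, u.2) | u <- terms r]
  end.

Fixpoint sumtree_wf (t : sumtree) : Prop :=
  match t with
  | Leaf _ => True
  | Node g neg l r =>
      [/\ operands g = [:: gate_vertex (root l); gate_vertex (root r)],
          forall u v, op g [:: u; v] = if neg then u - v else u + v,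
          sumtree_wf l & sumtree_wf r]
  end.

Definition column_pairs (m t : nat) : seq ('I_m * 'I_m) :=
  [seq ij <- enum {: 'I_m * 'I_m} | (val ij.1 + val ij.2 == t)%N].

(* Gates [own] multiply the m-digit [a] and [b] by a standard algorithm.
   [prod i j] is A[i]B[j]; [tree t] sums the products with i + j = t together
   with carries [carry t], which come from the columns below t; the digit
   [c t] is what remains of the total of column t once multiples of s are
   carried on. *)
Definition standard_algorithm (m : nat) (a b : m.-tuple vertex)
    (c : m.*2.-tuple (gate G)) (own : {set gate G}) : Prop :=
  exists (prod : 'I_m -> 'I_m -> gate G) (tree : 'I_(m.*2) -> sumtree)
         (carry : 'I_(m.*2) -> {set gate G}),
  let column (t : 'I_(m.*2)) :=
    [seq prod ij.1 ij.2 | ij <- column_pairs m t] ++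
    inner (tree t) ++ enum (carry t) ++ [:: tnth c t] in
  let layout := flatten [seq column t | t : 'I_(m.*2)] in
  [/\ uniq layout /\ own = [set g in layout],
      forall i j, operands (prod i j) = [:: tnth a i; tnth b j] /\
                  forall u v, op (prod i j) [:: u; v] = u * v,
      forall t, sumtree_wf (tree t) /\
        perm_eq [seq u <- terms (tree t) | u.2 \notin carry t]
          [seq (false, prod ij.1 ij.2) | ij <- column_pairs m t],
      forall t g u, g \in carry t -> u \in operands g ->
        exists t' : 'I_(m.*2), (t' < t)%N /\ u \in map gate_vertex (column t')
    & (forall t, operands (tnth c t) = [:: gate_vertex (root (tree t))] /\
                 forall u, op (tnth c t) [:: u] = (u %% s)%Z) /\
      (forall x, num x (map gate_vertex c) = num x a * num x b)].

(* Gates [own] compute the 2m digits [c] of the product of the m-digit [a] and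
   [b] as prescribed by [f].  In a Toom-k step, [own] splits into evaluation
   gates [EA] (which see A only) and [EB] (which see B only), disjoint gate sets
   [sub_own j] for the sub-problems, and gates [RC] that interpolate and
   recompose.  As the evaluation points may be negative, the j-th sub-problem
   multiplies the magnitudes of p(x_j) and q(x_j), and the signs [sgA j] and
   [sgB j] are put back at interpolation. *)
Fixpoint implements (f : instruction) (m : nat) (a b : m.-tuple vertex)
    (c : m.*2.-tuple (gate G)) (own : {set gate G}) {struct f} : Prop :=
  [/\ forall i, digit_vertex (tnth a i), forall i, digit_vertex (tnth b i),
      forall i, digit_vertex (gate_vertex (tnth c i))
    & match f with
      | Standard => standard_algorithm a b c own
      | ToomCook k pt sz sub =>
          let q := toom_branches k in
          let h := ((m + k.-1) %/ k)%N in
          exists (a' b' : forall j : 'I_q, (sz j).-tuple vertex)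
                 (c' : forall j : 'I_q, (sz j).*2.-tuple (gate G))
                 (sgA sgB : 'I_q -> gate G) (r : 'I_q -> seq (gate G))
                 (EA EB RC : seq (gate G)) (sub_own : 'I_q -> {set gate G}),
          let layout :=
            EA ++ EB ++ RC ++ flatten [seq enum (sub_own j) | j : 'I_q] in
          let products := flatten [seq val (c' j) | j : 'I_q] in
          let pA x := block_poly x k h a in
          let pB x := block_poly x k h b in
          [/\ [/\ uniq layout, own = [set g in layout],
                  reads_only EA a, reads_only EB b
                & reads_only RC (map gate_vertex
                    (products ++ map sgA (enum 'I_q) ++ map sgB (enum 'I_q)))],
              forall j, [/\ sgA j \in EA, sgB j \in EB,
                {subset a' j <= val a ++ map gate_vertex EA}
                & {subset b' j <= val b ++ map gate_vertex EB}],
              forall j x,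
                let eA := value x (gate_vertex (sgA j)) in
                let eB := value x (gate_vertex (sgB j)) in
                [/\ `|eA| = 1, `|eB| = 1,
                    (pA x).[pt j] = eA * num x (a' j)
                  & (pB x).[pt j] = eB * num x (b' j)],
              forall j, implements (sub j) (a' j) (b' j) (c' j) (sub_own j)
            & [/\ forall e, {subset r e <= products ++ RC},
                  {subset c <= products ++ RC},
                  forall e g, g \in r e -> digit_vertex (gate_vertex g),
                  forall x,
                    \row_e (num x (map gate_vertex (r e)))%:~R =
                    (\row_j (value x (gate_vertex (sgA j)) *
                             value x (gate_vertex (sgB j)) *
                             num x (map gate_vertex (c' j)))%:~R : 'rV[rat]_q)
                    *m invmx (Vandermonde q (\row_j (pt j)%:~R))
                & forall x,
                    num x (map gate_vertex c) =
                    \sum_e num x (map gate_vertex (r e)) * s%:Z ^+ (e * h)]]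
      end].

Definition digits_A : n.-tuple vertex := [tuple inl (inl i) | i < n].
Definition digits_B : n.-tuple vertex := [tuple inl (inr i) | i < n].

Definition hybrid_algorithm (f : instruction) : Prop :=
  [/\ class_H f n, cdag_wf
    & exists c, implements f digits_A digits_B c [set: gate G]].

(* A pair (v, l): the l-th of the memory words that hold the result v. *)
Definition word : finType := {v : vertex & 'I_(words v)}.

Section Machine.
Variables (P Bm : nat).

Definition memory := 'I_P -> {set word}.

Inductive event : Type :=
| Compute (p : 'I_P) (g : gate G)
| Message (src dst : 'I_P) (ws : {set word}).

Definition holds (mem : memory) (p : 'I_P) (v : vertex) : Prop :=
  forall w : word, tag w = v -> w \in mem p.

Definition enabled (mem : memory) (e : event) : Prop :=
  match e with
  | Compute p g => forall u, u \in operands g -> holds mem p u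
  | Message src dst ws => ws \subset mem src /\ (#|ws| <= Bm)%N
  end.

(* Local memories are unbounded, so nothing ever needs to be discarded. *)
Definition step (mem : memory) (e : event) : memory :=
  match e with
  | Compute p g => fun p' =>
      if p' == p then mem p' :|: [set w | tag w == gate_vertex g] else mem p'
  | Message src dst ws => fun p' =>
      if p' == dst then mem p' :|: ws else mem p'
  end.

Fixpoint run (mem : memory) (es : seq event) : Prop :=
  match es with
  | [::] => True
  | e :: es' => enabled mem e /\ run (step mem e) es'
  end.

(* [init p] is the set of input digits that p holds at the beginning; [inl i]
   stands for A[i] and [inr i] for B[i]. *)
Definition initial_memory (init : 'I_P -> {set ('I_n + 'I_n)}) : memory :=
  fun p => [set w : word | if tag w is inl i then i \in init p else false].

(* Recomputation is allowed: several events may compute the same gate. *)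
Definition execution (init : 'I_P -> {set ('I_n + 'I_n)})
    (es : seq event) : Prop :=
  run (initial_memory init) es /\
  forall g, has (fun e => if e is Compute _ g' then g' == g else false) es.

Definition messages (p : 'I_P) (es : seq event) : nat :=
  count (fun e => if e is Message src dst _ then (p == src) || (p == dst)
                  else false) es.

End Machine.
End Dag.

Definition placement_bound (R : realType) (n P : nat) (alpha : R)
    (init : 'I_P -> {set ('I_n + 'I_n)}) : Prop :=
  forall p,
    (#|[set i | inl i \in init p]|)%:R <= alpha * n%:R / P%:R /\
    (#|[set i | inr i \in init p]|)%:R <= alpha * n%:R / P%:R.

Definition msp_bound (R : realType) (f : instruction) (n P : nat) (alpha : R)
    : R :=
  \big[Num.max/0]_(n' < n.+1 | alpha * n%:R / P%:R <= n'%:R)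
     (n'%:R * Num.min (1 / 4)
        (Num.sqrt ((nu1 n' f n)%:R / (8 * P%:R)) +
         (nu n' f n)%:R / (2 * P%:R))).

(* Main.v *)
(* Fix n' and let N = ceil(n'/2).  The size condition of the class makes the
   lowest block of every problem that has a sub-problem of size at least n' at
   least N digits long.  So if only the N lowest digits of A and B are non-zero,
   all evaluation polynomials met on the way to an n'-MSP are constant, and the
   MSP multiplies A and B themselves.  Let W bound the number of words that any
   processor sends or receives.  Counting inputs with free digits of A shows that
   a processor can hold at most K = alpha n/P + 2 W of the N lowest input digits
   of A in any MSP.

   Outputs: for B = s^b the product digit e + b is A[e].  A processor that computes
   it without holding digit e of the MSP input must learn it from words of gates of
   the MSP, and these gate sets are disjoint.  Counting triples (MSP, e, b) gives
   nu (N - 2 K) <= 2 P W.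

   Products: if 2 K <= N, no processor computes all products of a column
   t in [N/2, N) of a Type 1 MSP, so every processor that contributes to the column
   sends or receives a word of its own summation tree.  Hence at most W columns
   concern a processor, in each of which it computes at most K products, and
   nu1 N^2 <= 4 P W K.

   The two inequalities imply the bound with constant 1/6. *)
Require Import Defs.
From HB Require Import structures.
From mathcomp Require Import all_boot all_order all_algebra.
From mathcomp Require Import reals.
From mathcomp Require Import zify ring lra.
Import Order.TTheory GRing.Theory Num.Theory.

Set Implicit Arguments.
Unset Strict Implicit.
Unset Printing Implicit Defensive.

Local Open Scope ring_scope.

(** * Digit strings and interpolation *)

Section DigitStrings.
Variable s : nat.
Implicit Types l : seq int.

Definition dnum l : int := foldr (fun d acc => d + s%:Z * acc) 0 l.

Definition digits l := all (fun d => (0 <= d) && (d < s%:Z)) l.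

Lemma dnum_ge0 l : digits l -> 0 <= dnum l.
Proof.
elim: l => //= d l IH /andP[/andP[d0 _] /IH l0].
by rewrite addr_ge0 // mulr_ge0.
Qed.

Lemma dnum_cat l1 l2 : dnum (l1 ++ l2) = dnum l1 + s%:Z ^+ size l1 * dnum l2.
Proof.
elim: l1 => [|d l1 IH] /=; first by rewrite expr0 mul1r add0r.
by rewrite IH exprS; ring.
Qed.

Lemma dnum_eq0 l : digits l -> dnum l = 0 -> forall i, l`_i = 0.
Proof.
elim: l => [_ _ i|d l IH /= /andP[/andP[d0 ds] dl]]; first by rewrite nth_nil.
have l0 := dnum_ge0 dl; move=> E.
have d00 : d = 0 by have := mulr_ge0 (ler0n int s) l0; lia.
have s0 : s%:Z != 0 by lia.
move: E; rewrite d00 add0r => /eqP; rewrite mulf_eq0 (negbTE s0) /= => /eqP E.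
by case=> [|i] //=; exact: IH.
Qed.

(** The lowest digits agree modulo [s], and the rest follows by induction. The default 0 of [nth]
    lets strings of different lengths be compared. *)
Lemma dnum_inj l1 l2 : digits l1 -> digits l2 -> dnum l1 = dnum l2 ->
  forall i, l1`_i = l2`_i.
Proof.
elim: l1 l2 => [|d1 l1 IH] l2.
  by move=> _ D2 /= /esym/(dnum_eq0 D2) E i; rewrite E nth_nil.
case: l2 => [D1 _ /(dnum_eq0 D1) E i|d2 l2]; first by rewrite E nth_nil.
move=> /= /andP[/andP[d10 d1s] D1] /andP[/andP[d20 d2s] D2] E.
have s0 : s%:Z != 0 by lia.
have Ed : d1 = d2.
  have M (d : int) (t : int) : 0 <= d -> d < s%:Z -> ((d + s%:Z * t) %% s)%Z = d.
    by move=> d0 ds; rewrite addrC mulrC modzMDl modz_small // d0.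
  by rewrite -(M _ (dnum l1) d10 d1s) E M.
have El : dnum l1 = dnum l2.
  by move: E; rewrite Ed => /addrI /(mulfI s0).
by case=> [|i] //=; exact: IH.
Qed.

Lemma dnum_zero l : (forall i, l`_i = 0) -> dnum l = 0.
Proof.
elim: l => //= d l IH E; rewrite (E 0%N : d = 0) IH ?mulr0 ?addr0 //.
by move=> i; exact: (E i.+1).
Qed.

Lemma eq_dnum l1 l2 : (forall i, l1`_i = l2`_i) -> dnum l1 = dnum l2.
Proof.
elim: l1 l2 => [|d1 l1 IH] l2 E.
  by rewrite [RHS]dnum_zero // => i; rewrite -E nth_nil.
case: l2 E => [E|d2 l2 E].
  by rewrite [LHS]dnum_zero // => i; rewrite E nth_nil.
by rewrite /= (E 0%N : d1 = d2) (IH l2) // => i; exact: (E i.+1).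
Qed.

Lemma dnum_nseq0 k l : dnum (nseq k 0 ++ l) = s%:Z ^+ k * dnum l.
Proof.
rewrite dnum_cat size_nseq dnum_zero ?add0r // => i.
by rewrite nth_nseq if_same.
Qed.

Definition blocks k h l : {poly int} := \poly_(e < k) dnum (take h (drop (e * h) l)).

Lemma horner_blocks k h l : (size l <= k * h)%N ->
  (blocks k h l).[s%:Z ^+ h] = dnum l.
Proof.
(* Truncating [l] to [k * h] digits frees the induction on [k] from the length bound. *)
move=> lk; rewrite /blocks horner_poly -[RHS](congr1 dnum (take_oversize lk)).
elim: k {lk} => [|k IH]; first by rewrite big_ord0 mul0n take0.
rewrite big_ord_recr /= IH mulSn addnC takeD dnum_cat -exprM size_take.
case: ltnP => [_|kl]; first by rewrite mulrC (mulnC h).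
by rewrite (drop_oversize kl) /= mul0r mulr0.
Qed.

Lemma blocks_const k h l : (0 < k)%N -> (forall i, (h <= i)%N -> l`_i = 0) ->
  blocks k h l = (dnum l)%:P.
Proof.
move=> k0 l0; apply/polyP=> e; rewrite coef_poly coefC.
case: e => [|e] /=.
  rewrite k0 mul0n drop0; apply: eq_dnum => i.
  case: (ltnP i h) => ih; first by rewrite nth_take.
  by rewrite nth_default ?l0 // size_take_min; apply: leq_trans ih; rewrite geq_minl.
case: ifP => // _; apply: dnum_zero => i.
case: (ltnP i h) => ih.
  by rewrite nth_take // nth_drop l0 // mulSn -addnA leq_addr.
by rewrite nth_default // size_take_min; apply: leq_trans ih; rewrite geq_minl.
Qed.

End DigitStrings.

(** The values of [p] at the points are its coefficient row times the Vandermonde matrix, which is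
    invertible because the points are distinct; the size bound ensures that no coefficient is
    lost. *)
Lemma interpolation q (pt : 'I_q -> int) (p : {poly int}) (r : 'I_q -> int) :
  injective pt -> (size p <= q)%N ->
  \row_e (r e)%:~R =
    (\row_j (p.[pt j])%:~R : 'rV[rat]_q)
      *m invmx (Vandermonde q (\row_j (pt j)%:~R)) ->
  forall e, r e = p`_e.
Proof.
move=> pt_inj sp E.
set V := Vandermonde _ _ in E.
have Vu : V \in unitmx.
  rewrite unitmxE unitfE det_Vandermonde; apply/prodf_neq0 => i _.
  apply/prodf_neq0 => j ij; rewrite !mxE subr_eq0 eqr_int.
  by apply: contraTneq ij => /pt_inj ->; rewrite ltnn.
have C : \row_j (p.[pt j])%:~R = (\row_e (p`_e)%:~R : 'rV[rat]_q) *m V.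
  apply/rowP=> j; rewrite !mxE (horner_coef_wide _ sp) rmorph_sum /=.
  by apply: eq_bigr => e _; rewrite !mxE rmorphM rmorphXn.
move: E; rewrite C mulmxK // => /rowP E e.
by have /eqP := E e; rewrite !mxE eqr_int => /eqP.
Qed.

(** * Correctness and locality of hybrid algorithms *)

Arguments value : simpl never.

Section Dag.
Variables (s n : nat) (G : cdag n).
Implicit Types (x y : inputs s n) (v u : vertex G) (g : gate G).
Implicit Types (own : {set gate G}).

Lemma numE x (a : seq (vertex G)) : num x a = dnum s [seq value x v | v <- a].
Proof. by rewrite /dnum /num foldr_map. Qed.

Lemma block_polyE x k h (a : seq (vertex G)) :
  block_poly x k h a = blocks s k h [seq value x v | v <- a].
Proof.
by apply/polyP=> e; rewrite !coef_poly numE map_take map_drop.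
Qed.

Definition inside own v : bool := if v is inr g then g \in own else false.

Lemma mem_gate_vertex g (E : seq (gate G)) :
  (gate_vertex g \in map (@gate_vertex n G) E) = (g \in E).
Proof. by apply: mem_map => ? ? []. Qed.

Lemma inside_map (E : seq (gate G)) own u :
  {subset E <= own} -> u \in map (@gate_vertex n G) E -> inside own u.
Proof. by move=> EO /mapP[g gE ->]; exact: EO. Qed.

(** Levels decrease strictly along operands, so any fuel above the level of a gate yields the same
    value. *)
Lemma value_gate x g : cdag_wf s G ->
  value x (gate_vertex g) = op g [seq value x u | u <- operands g].
Proof.
move=> [lev _].
have ev d (h : gate G) : (level h < d)%N -> eval d x (inr h) = value x (inr h).
  elim/ltn_ind: d h => d IH h; case: d IH => // d IH lh.
  rewrite /value /=; congr op; apply/eq_in_map => -[u|h'] hh.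
    by case: u hh => ? _; case: d {IH lh}; case: (level h).
  have lt := lev _ _ hh.
  have ld : (level h' < d)%N by apply: leq_trans lt _; rewrite -ltnS.
  rewrite (IH d) //; have := IH (level h); rewrite ltnS => -> //.
rewrite /value /=; congr op; apply/eq_in_map => -[u|h] hh.
  by case: u hh => ? _; case: (level g).
by apply: ev; exact: lev.
Qed.

Lemma digits_value m (a : m.-tuple (vertex G)) x :
  (forall i, digit_vertex s (tnth a i)) -> digits s [seq value x v | v <- a].
Proof.
move=> da; apply/allP => d /mapP[v /tnthP[i ->] ->].
by have [_ /(_ x)] := da i.
Qed.

Lemma implements_out f m (a b : m.-tuple (vertex G)) c own :
  implements s f a b c own -> {subset c <= own}.
Proof.
elim: f m a b c own => [|k pt sz sub IH] m a b c own /=.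
  case=> _ _ _ [prod [tree [carry /= [[_ ->] _ _ _ _]]]] g /tnthP[t ->].
  rewrite inE; apply/flatten_mapP; exists t; first exact: mem_enum.
  by rewrite !mem_cat mem_seq1 eqxx !orbT.
case=> _ _ _ [a' [b' [c' [sgA [sgB [r [EA [EB [RC [sub_own /=]]]]]]]]]].
case=> [[_ -> _ _ _] _ _ Hsub [_ cin _ _ _]] g /cin.
rewrite inE !mem_cat => /orP[/flatten_mapP[j _ gj]|->]; last by rewrite !orbT.
apply/orP; right; apply/orP; right; apply/orP; right.
apply/flatten_mapP; exists j; first exact: mem_enum.
by rewrite mem_enum; apply: (IH j _ _ _ _ _ (Hsub j)).
Qed.

(** For a standard algorithm this is part of the definition. In a Toom-k step the signed products
    are the values of [pA * pB] at the points, so interpolation returns its coefficients, and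
    recomposition is evaluation at [s ^ h]. *)
Lemma implements_num f m (a b : m.-tuple (vertex G)) c own x :
  class_H f m -> implements s f a b c own ->
  num x (map (@gate_vertex n G) c) = num x a * num x b.
Proof.
elim: f m a b c own => [|k pt sz sub IH] m a b c own /=.
  by move=> _ [_ _ _ [prod [tree [carry /= [_ _ _ _ [_ ->]]]]]].
case=> k2 pt_inj _ Hc.
case=> _ _ _ [a' [b' [c' [sgA [sgB [r [EA [EB [RC [sub_own /=]]]]]]]]]].
case=> [_ _ Hev Hsub [_ _ _ rE ->]].
set h := ((m + k.-1) %/ k)%N in Hev *.
set pA := block_poly x k h a; set pB := block_poly x k h b.
have mkh : (m <= k * h)%N.
  have k0 : (0 < k)%N by apply: leq_trans k2.
  have := ltn_ceil (m + k.-1)%N k0; rewrite -/h; nia.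
have hA : pA.[s%:Z ^+ h] = num x a.
  by rewrite /pA block_polyE numE horner_blocks // size_map size_tuple.
have hB : pB.[s%:Z ^+ h] = num x b.
  by rewrite /pB block_polyE numE horner_blocks // size_map size_tuple.
have sAB : (size (pA * pB)%R <= k.*2.-1)%N.
  apply: leq_trans (size_polyMleq _ _) _; rewrite -!subn1 leq_sub2r // -addnn.
  by rewrite leq_add // size_poly.
have rC := interpolation (r := fun e => num x (map (@gate_vertex n G) (r e)))
  pt_inj sAB.
rewrite -hA -hB -hornerM (horner_coef_wide _ sAB).
apply: eq_bigr => e _; rewrite -exprM (mulnC h) rC //.
rewrite rE; congr (_ *m _); apply/rowP=> j; rewrite !mxE hornerM.
have [_ _ EA' EB'] := Hev j x.
rewrite (IH _ _ _ _ _ _ (Hc j) (Hsub j)); congr (_%:~R).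
by rewrite EA' EB'; ring.
Qed.

Definition tree_gates (t : sumtree G) := inner t ++ map snd (terms t).

Lemma root_tree_gates (t : sumtree G) g :
  g = Defs.root t -> g \in tree_gates t.
Proof.
move=> ->; rewrite /tree_gates; elim: t => [h|h neg l _ r _] /=; by rewrite inE eqxx.
Qed.

Lemma tree_gatesNode g neg (l r : sumtree G) :
  tree_gates (Node g neg l r) =i g :: tree_gates l ++ tree_gates r.
Proof.
move=> h; rewrite /tree_gates /= !inE !mem_cat map_cat mem_cat -map_comp.
rewrite (eq_map (g := snd)) //.
by rewrite -!orbA; congr (_ || (_ || _)); rewrite orbCA.
Qed.

Lemma inner_operands (t : sumtree G) g u :
  sumtree_wf t -> g \in inner t -> u \in operands g ->
  u \in map (@gate_vertex n G) (tree_gates t).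
Proof.
elim: t => // h neg l IHl r IHr [opE _ wl wr].
have sub (t' : sumtree G) : {subset tree_gates t' <= tree_gates l ++ tree_gates r} ->
  u \in map (@gate_vertex n G) (tree_gates t') ->
  u \in map (@gate_vertex n G) (tree_gates (Node h neg l r)).
  move=> S /mapP[g' /S gS ->]; rewrite mem_gate_vertex tree_gatesNode inE.
  by rewrite gS orbT.
move=> gin ug; have: [|| g == h, g \in inner l | g \in inner r].
  by rewrite -mem_cat -in_cons.
case/or3P=> [/eqP gh|gl|gr].
- have: (u == gate_vertex (Defs.root l)) || (u == gate_vertex (Defs.root r)).
    by move: ug; rewrite gh opE !inE.
  case/orP=> /eqP ->; rewrite mem_gate_vertex tree_gatesNode.
    by rewrite inE mem_cat (@root_tree_gates l) ?orbT.
  by rewrite inE mem_cat (@root_tree_gates r) ?orbT.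
- by apply: (sub l) (IHl wl gl ug) => z zl; rewrite mem_cat zl.
- by apply: (sub r) (IHr wr gr ug) => z zr; rewrite mem_cat zr orbT.
Qed.

Lemma tree_gates_column m (t : sumtree G) (carry : {set gate G})
    (prods : seq ('I_m * 'I_m)) (prod : 'I_m -> 'I_m -> gate G) c :
  perm_eq [seq u <- terms t | u.2 \notin carry]
          [seq (false, prod ij.1 ij.2) | ij <- prods] ->
  {subset tree_gates t <= [seq prod ij.1 ij.2 | ij <- prods] ++
    inner t ++ enum carry ++ [:: c]}.
Proof.
move=> pe g; rewrite /tree_gates mem_cat !mem_cat => /orP[->|].
  by rewrite orbT.
case/mapP=> [[sg h]] ht /= ->; case hc: (h \in carry).
  by rewrite mem_enum hc !orbT.
have: (sg, h) \in [seq u <- terms t | u.2 \notin carry] by rewrite mem_filter /= hc.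
rewrite (perm_mem pe) => /mapP[ij ijp [_ ->]].
by rewrite (map_f (fun ij => prod ij.1 ij.2)).
Qed.

(** Locality: data enter a gate set only through the two inputs. Inputs of a sub-problem come from
    [a], [b] or evaluation gates, and the gates [RC] read outputs that belong to the
    sub-problems. *)
Lemma implements_closed f m (a b : m.-tuple (vertex G)) c own g u :
  implements s f a b c own -> g \in own -> u \in operands g ->
  [|| u \in a, u \in b | inside own u].
Proof.
elim: f m a b c own g u => [|k pt sz sub IH] m a b c own g u /=.
  case=> _ _ _ [prod [tree [carry /=]]].
  set column := fun t => _ ++ _ ++ _ ++ [:: tnth c t].
  case=> [[_ ->] Hprod Htree Hcarry [Hc _]].
  have sub t : {subset column t <= [set g in flatten [seq column t | t : 'I_(m.*2)]]}.
    move=> z zt; rewrite inE; apply/flatten_mapP; exists t => //; exact: mem_enum.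
  have subT t : {subset tree_gates (tree t) <= column t}.
    by apply: tree_gates_column; case: (Htree t).
  rewrite inE => /flatten_mapP[t _]; rewrite /column !mem_cat.
  case/or4P=> [/mapP[ij _ ->]|gi ug|gc ug|].
  - have [-> _] := Hprod ij.1 ij.2.
    by rewrite !inE => /orP[]/eqP->; rewrite mem_tnth ?orbT.
  - have [wf _] := Htree t.
    rewrite (@inside_map (tree_gates (tree t)) _ u) ?orbT //.
      by move=> z /subT /sub.
    exact: inner_operands wf gi ug.
  - rewrite mem_enum in gc; have [t' [_ ut']] := Hcarry t g u gc ug.
    by rewrite (inside_map (@sub t') ut') !orbT.
  - rewrite inE => /eqP ->; have [-> _] := Hc t; rewrite inE => /eqP ->.
    apply/orP; right; apply/orP; right; apply: (sub t); apply: subT.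
    exact: root_tree_gates.
case=> _ _ _ [a' [b' [c' [sgA [sgB [r [EA [EB [RC [sub_own /=]]]]]]]]]].
case=> [[_ -> rA rB rRC] Hin _ Hsub _].
set O := [set g in _].
have SA : {subset EA <= O} by move=> z zE; rewrite inE !mem_cat zE.
have SB : {subset EB <= O} by move=> z zE; rewrite inE !mem_cat zE orbT.
have SR : {subset RC <= O} by move=> z zE; rewrite inE !mem_cat zE !orbT.
have SS j : {subset sub_own j <= O}.
  move=> z zE; rewrite inE !mem_cat; apply/orP; right; apply/orP; right.
  apply/orP; right; apply/flatten_mapP; exists j; first exact: mem_enum.
  by rewrite mem_enum.
rewrite inE !mem_cat => /or4P[gE|gE|gE|/flatten_mapP[j _ gj]] ug.
- by have := rA g gE u ug; rewrite mem_cat => /orP[->|/(inside_map SA)->];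
    rewrite ?orbT.
- by have := rB g gE u ug; rewrite mem_cat => /orP[->|/(inside_map SB)->];
    rewrite ?orbT.
- have := rRC g gE u ug; rewrite mem_cat => /orP[|/(inside_map SR)->];
    rewrite ?orbT //.
  case/mapP=> h; rewrite !mem_cat => /or3P[/flatten_mapP[j _ hj]|/mapP[j _ ->]|/mapP[j _ ->]] ->.
  + by rewrite /= (SS j) ?orbT //; apply: implements_out (Hsub j) _ hj.
  + by rewrite /= SA ?orbT //; case: (Hin j).
  + by rewrite /= SB ?orbT //; case: (Hin j).
- rewrite mem_enum in gj; case/or3P: (IH j _ _ _ _ _ _ _ (Hsub j) gj ug).
  + by have [_ _ S _] := Hin j; move/S; rewrite mem_cat => /orP[->|/(inside_map SA)->];
      rewrite ?orbT.
  + by have [_ _ _ S] := Hin j; move/S; rewrite mem_cat => /orP[->|/(inside_map SB)->];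
      rewrite ?orbT.
  + by case: u {ug} => //= h /SS ->; rewrite !orbT.
Qed.

Lemma implements_digits f m (a b : m.-tuple (vertex G)) c own x :
  implements s f a b c own ->
  [/\ digits s [seq value x v | v <- a], digits s [seq value x v | v <- b]
    & digits s [seq value x (gate_vertex g) | g <- c]].
Proof.
have dc : (forall i, digit_vertex s (gate_vertex (tnth c i))) ->
  digits s [seq value x (gate_vertex g) | g <- c].
  by move=> dc; apply/allP => d /mapP[v /tnthP[i ->] ->]; have [_ /(_ x)] := dc i.
by case: f => [|k pt sz sub] /= [da db /dc ? _]; split=> //; apply: digits_value.
Qed.

Lemma class_H_nu0 n' f m : class_H f m -> (m < n')%N ->
  nu1 n' f m = 0%N /\ nu2 n' f m = 0%N.
Proof.
elim: f m => [|k pt sz sub IH] m /=; first by move=> _; rewrite ltnNge => /negbTE->.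
case=> _ _ Hsz Hc mn; rewrite [(n' <= m)%N]leqNgt mn /= add0n.
have Hj j : (sz j < n')%N by case: (Hsz j) => _ /ltn_trans; apply.
by split; apply: big1 => j _; case: (IH j (sz j)).
Qed.

(** * Maximal sub-problems *)

Section MaximalSubproblems.
Variables (N : nat) (v0 : vertex G).

Definition low x : Prop :=
  forall i : 'I_n, (N <= i)%N -> (x.1 i = 0 :> nat) /\ (x.2 i = 0 :> nat).

(** Numbers are compared rather than digit strings, since a sub-problem has other input vertices and
    another length. *)
Definition low_spec (a b : seq (vertex G)) :=
  forall x, low x -> num x a = num x (digits_A G) /\ num x b = num x (digits_B G).

Record msp := Msp {
  is_standard : bool;
  ina : seq (vertex G);
  inb : seq (vertex G);
  out : seq (gate G);
  own_gates : {set gate G}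
}.

(* The sets [S M] are disjoint parts of [own], stated additively so that it
   passes through the recursion on instructions. *)
Definition packs (T : Type) (r : seq T) (S : T -> {set gate G}) own : Prop :=
  forall F : gate G -> nat,
    (\sum_(M <- r) \sum_(g in S M) F g <= \sum_(g in own) F g)%N.

(** The part of a standard algorithm that the product count uses: columns below [N], natural
    indices, carries absorbed in [col]. Only the operand from [a] is recorded, as only digits of A
    are counted. *)
Definition summed_columns (a : seq (vertex G)) own : Prop :=
  exists (prod : nat -> nat -> gate G) (tree : nat -> sumtree G)
    (col : nat -> {set gate G}),
  [/\ forall t, (t < N)%N -> sumtree_wf (tree t) /\ {subset tree_gates (tree t) <= col t},
      packs (iota 0 N) col own
    & forall i t, (i <= t < N)%N ->
        prod i (t - i)%N \in map snd (terms (tree t)) /\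
        nth v0 a i \in operands (prod i (t - i)%N)].

(** The interface between the recursion and the counting. The [N.*2] outputs cover all positions
    [e + b] with [e] and [b] below [N]. *)
Definition msp_spec (M : msp) : Prop :=
  [/\ forall x, [/\ digits s [seq value x v | v <- ina M],
        digits s [seq value x v | v <- inb M],
        digits s [seq value x (gate_vertex g) | g <- out M]
      & num x (map (@gate_vertex n G) (out M)) = num x (ina M) * num x (inb M)],
      low_spec (ina M) (inb M),
      forall g u, g \in own_gates M -> u \in operands g ->
        [|| u \in ina M, u \in inb M | inside (own_gates M) u],
      {subset out M <= own_gates M} /\ (N.*2 <= size (out M))%N
    & is_standard M -> summed_columns (ina M) (own_gates M)].

Lemma uniq_flatten (T : eqType) (ss : seq (seq T)) r :
  uniq (flatten ss) -> r \in ss -> uniq r.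
Proof.
elim: ss => //= r' ss IH; rewrite cat_uniq inE => /and3P[U _ /IH Us].
by case/orP=> [/eqP->|].
Qed.

Lemma sum_flatten (T : Type) (r : seq T) (S : T -> {set gate G}) (F : gate G -> nat) :
  (\sum_(j <- r) \sum_(g in S j) F g =
   \sum_(g <- flatten [seq enum (S j) | j <- r]) F g)%N.
Proof.
rewrite big_flatten big_map; apply: eq_bigr => j _.
by rewrite -big_enum.
Qed.

Lemma standard_columns m (a b : m.-tuple (vertex G)) c own :
  (0 < m)%N -> (N <= m)%N -> standard_algorithm s a b c own ->
  summed_columns a own.
Proof.
case: m a b c => // m a b c _ Nm [prod [tree [carry /=]]].
set column := fun t => _ ++ _ ++ _ ++ [:: tnth c t].
case=> [[U ->] Hprod Htree _ _].
(* Indices out of range default to 0; only those below [N], which are in range, matter. *)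
pose o (i : nat) : 'I_m.+1 := insubd ord0 i.
pose o2 (i : nat) : 'I_(m.+1.*2) := insubd ord0 i.
have oE i : (i < N)%N -> val (o i) = i.
  by move=> iN; rewrite /o val_insubd (leq_trans iN Nm).
have o2E i : (i < N)%N -> val (o2 i) = i.
  move=> iN; rewrite /o2 val_insubd (leq_trans iN) // (leq_trans Nm) //.
  by rewrite -addnn leq_addr.
exists (fun i j => prod (o i) (o j)), (fun t => tree (o2 t)),
  (fun t => [set g in column (o2 t)]); split.
- move=> t tN; have [wf pe] := Htree (o2 t); split=> // g gt.
  by rewrite inE; apply: (tree_gates_column _ _ gt).
- move=> F; pose K t := (\sum_(g in [set g in column (o2 t)]) F g)%N.
  rewrite -[X in iota 0 X]subn0 -/(index_iota 0 N) big_mkord.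
  have N2 : (N <= m.+1.*2)%N by rewrite (leq_trans Nm) // -addnn leq_addr.
  rewrite (big_ord_widen _ K N2) big_mkcond /=.
  apply: (@leq_trans (\sum_(t < m.+1.*2) K t)%N).
    by apply: leq_sum => t _; case: ifP.
  have -> : (\sum_(g in [set g in flatten [seq column t | t : 'I_(m.+1.*2)]]) F g =
             \sum_(g <- flatten [seq column t | t : 'I_(m.+1.*2)]) F g)%N.
    by rewrite big_uniq //=; apply: eq_bigl => g; rewrite inE.
  rewrite big_flatten big_map big_enum /=; apply: leq_sum => t _.
  rewrite /K /o2 valKd big_uniq /=; last first.
    by apply: uniq_flatten U _; apply: map_f; rewrite mem_enum.
  by apply: eq_leq; apply: eq_bigl => g; rewrite inE.
- move=> i t /andP[it tN]; have iN := leq_ltn_trans it tN.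
  have [_ pe] := Htree (o2 t); split.
    have: (false, prod (o i) (o (t - i)%N)) \in [seq u <- terms (tree (o2 t)) | u.2 \notin carry (o2 t)].
      rewrite (perm_mem pe); apply/mapP; exists (o i, o (t - i)%N) => //.
      rewrite mem_filter mem_enum andbT /= !oE ?o2E //; last exact: leq_ltn_trans (leq_subr _ _) tN.
      by rewrite subnKC.
    by rewrite mem_filter => /andP[_ /(map_f snd)].
  have [-> _] := Hprod (o i) (o (t - i)%N).
  by rewrite (tnth_nth v0) oE // inE eqxx.
Qed.

Lemma value_digits_A x i :
  [seq value x v | v <- digits_A G]`_i = oapp (fun o : 'I_n => (x.1 o : nat)%:Z) 0 (insub i).
Proof.
case: insubP => [o _ <-|]; last first.
  rewrite -leqNgt => ni.
  by rewrite nth_default // size_map size_tuple.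
rewrite (nth_map (inl (inl o))); last by rewrite size_tuple ltn_ord.
by rewrite -tnth_nth tnth_mktuple.
Qed.

Lemma value_digits_B x i :
  [seq value x v | v <- digits_B G]`_i = oapp (fun o : 'I_n => (x.2 o : nat)%:Z) 0 (insub i).
Proof.
case: insubP => [o _ <-|]; last first.
  rewrite -leqNgt => ni.
  by rewrite nth_default // size_map size_tuple.
rewrite (nth_map (inl (inl o))); last by rewrite size_tuple ltn_ord.
by rewrite -tnth_nth tnth_mktuple.
Qed.

Lemma digits_digits_A x : digits s [seq value x v | v <- digits_A G].
Proof.
apply: digits_value => i; rewrite tnth_mktuple; split=> // y.
by apply/andP; split=> //; exact: ltn_ord.
Qed.

Lemma digits_digits_B x : digits s [seq value x v | v <- digits_B G].
Proof.
apply: digits_value => i; rewrite tnth_mktuple; split=> // y.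
by apply/andP; split=> //; exact: ltn_ord.
Qed.

Lemma low_digits_A x i : low x -> (N <= i)%N -> [seq value x v | v <- digits_A G]`_i = 0.
Proof.
move=> lx Ni; rewrite value_digits_A; case: insubP => //= o _ oi.
by case: (lx o); rewrite ?oi // => ->.
Qed.

Lemma low_digits_B x i : low x -> (N <= i)%N -> [seq value x v | v <- digits_B G]`_i = 0.
Proof.
move=> lx Ni; rewrite value_digits_B; case: insubP => //= o _ oi.
by case: (lx o); rewrite ?oi // => _ ->.
Qed.

(** By uniqueness of digits, the digits of [a] vanish from [N] on; only the lowest block survives
    and the polynomial is constant. *)
Lemma horner_low_block x k h (a d : seq (vertex G)) (pt : int) :
  (0 < k)%N -> (N <= h)%N ->
  digits s [seq value x v | v <- a] -> digits s [seq value x v | v <- d] ->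
  (forall i, (N <= i)%N -> [seq value x v | v <- d]`_i = 0) ->
  num x a = num x d -> (block_poly x k h a).[pt] = num x d.
Proof.
move=> k0 Nh da dd d0 E; rewrite block_polyE blocks_const ?hornerC -?numE //.
move=> i hi; rewrite (dnum_inj da dd) -?numE // d0 //; exact: leq_trans hi.
Qed.

Lemma sign_cancel (e u w : int) : `|e| = 1 -> 0 <= u -> 0 <= w -> u = e * w -> w = u.
Proof.
move=> e1 u0 w0; have [->|->] : e = 1 \/ e = -1 by lia.
  by lia.
by lia.
Qed.

(** Both polynomials are constant on low inputs, so evaluation returns A and B up to sign;
    non-negativity removes the sign. *)
Lemma toom_low_spec k h (a b a' b' : seq (vertex G)) (pt : int) (gA gB : gate G) :
  (0 < k)%N -> (N <= h)%N ->
  (forall x, [/\ digits s [seq value x v | v <- a], digits s [seq value x v | v <- b],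
      digits s [seq value x v | v <- a'] & digits s [seq value x v | v <- b']]) ->
  (forall x, let eA := value x (gate_vertex gA) in
     let eB := value x (gate_vertex gB) in
     [/\ `|eA| = 1, `|eB| = 1, (block_poly x k h a).[pt] = eA * num x a'
       & (block_poly x k h b).[pt] = eB * num x b']) ->
  low_spec a b -> low_spec a' b'.
Proof.
move=> k0 Nh D Hev ab x lx; have [Ea Eb] := ab x lx.
have [da db da' db'] := D x; have /= [eA eB EA EB] := Hev x.
have [dA dB] := (digits_digits_A x, digits_digits_B x); split.
  apply: (sign_cancel eA); rewrite ?numE ?dnum_ge0 // -!numE -EA.
  by rewrite (horner_low_block pt k0 Nh da dA) // => i; exact: low_digits_A.
apply: (sign_cancel eB); rewrite ?numE ?dnum_ge0 // -!numE -EB.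
by rewrite (horner_low_block pt k0 Nh db dB) // => i; exact: low_digits_B.
Qed.

End MaximalSubproblems.


(** Induction on the instruction. A problem smaller than [n'] yields no MSP; a standard problem, or
    a step with small sub-problems only, is itself one MSP; otherwise the families of the
    sub-problems are joined in a tagged union. *)
Lemma msp_family n' f m (a b : m.-tuple (vertex G)) c own v0 :
  (0 < n')%N -> class_H f m -> implements s f a b c own ->
  ((n' <= m)%N -> low_spec (uphalf n') a b) ->
  exists (I : finType) (F : I -> msp),
    [/\ forall i, msp_spec (uphalf n') v0 (F i), #|I| = nu n' f m,
        (\sum_i is_standard (F i))%N = nu1 n' f m
      & packs (index_enum I) (fun i => own_gates (F i)) own].
Proof.
move=> n'0; set N := uphalf n'.
have none f' m' own' : class_H f' m' -> (m' < n')%N ->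
  exists (I : finType) (F : I -> msp),
    [/\ forall i, msp_spec N v0 (F i), #|I| = nu n' f' m',
        (\sum_i is_standard (F i))%N = nu1 n' f' m'
      & packs (index_enum I) (fun i => own_gates (F i)) own'].
  move=> Hc mn; have [nu10 nu20] := class_H_nu0 Hc mn.
  exists void, (fun v : void => match v with end).
  split; first by case.
  - by rewrite card_void /nu nu10 nu20.
  - by rewrite nu10 big1 // => -[].
  - by move=> w; rewrite big1 // => -[].
have single f' m' (a' b' : m'.-tuple (vertex G)) c' own' (std : bool) :
  (n' <= m')%N -> class_H f' m' -> implements s f' a' b' c' own' ->
  low_spec N a' b' -> (std -> summed_columns N v0 a' own') ->
  nu n' f' m' = 1%N -> nu1 n' f' m' = std :> nat ->
  exists (I : finType) (F : I -> msp),
    [/\ forall i, msp_spec N v0 (F i), #|I| = nu n' f' m',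
        (\sum_i is_standard (F i))%N = nu1 n' f' m'
      & packs (index_enum I) (fun i => own_gates (F i)) own'].
  move=> nm Hc H lab Hstd nuE nu1E.
  exists unit, (fun=> Msp std a' b' c' own'); split.
  - move=> _; split=> //=.
    + move=> x; have [da db dc] := implements_digits x H.
      by split=> //; apply: implements_num Hc H.
    + move=> g u; exact: implements_closed H.
    + split; first exact: implements_out H.
      rewrite size_tuple leq_double leq_uphalf_double (leq_trans nm) //.
      by rewrite -addnn leq_addr.
  - by rewrite card_unit nuE.
  - by rewrite nu1E (big_pred1 tt) // => -[].
  - by move=> F; rewrite (big_pred1 tt) // => -[].
elim: f m a b c own => [|k pt sz sub IH] m a b c own Hc H lab.
  have [mn|nm] := ltnP m n'; first exact: none.
  have m0 := leq_trans n'0 nm.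
  have Nm : (N <= m)%N by rewrite leq_uphalf_double (leq_trans nm) // -addnn leq_addr.
  apply: (single _ _ _ _ _ _ true nm Hc H (lab nm)) => //=; rewrite /nu /= ?nm //.
  move=> _; case: H => _ _ _; exact: standard_columns.
have [mn|nm] := ltnP m n'; first exact: none.
have [small|] := boolP [forall j, (sz j < n')%N].
  have [_ _ Hsz Hcj] := Hc.
  have Z j := class_H_nu0 (Hcj j) (forallP small j).
  have nu10 : (\sum_j nu1 n' (sub j) (sz j))%N = 0%N.
    by rewrite big1 // => j _; case: (Z j).
  have nu20 : (\sum_j nu2 n' (sub j) (sz j))%N = 0%N.
    by rewrite big1 // => j _; case: (Z j).
  apply: (single _ _ _ _ _ _ false nm Hc H (lab nm)) => //=.
  by rewrite /nu /= nu10 nu20 nm small.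
move=> nsmall; have [k2 _ Hsz Hcj] := Hc.
have [_ _ _ [a' [b' [c' [sgA [sgB [r [EA [EB [RC [sub_own /=]]]]]]]]]]] := H.
case=> [[U ownE _ _ _] _ Hev Hsub _].
have k0 : (0 < k)%N by apply: leq_trans k2.
have Hj j : exists (I : finType) (F : I -> msp),
    [/\ forall i, msp_spec N v0 (F i), #|I| = nu n' (sub j) (sz j),
        (\sum_i is_standard (F i))%N = nu1 n' (sub j) (sz j)
      & packs (index_enum I) (fun i => own_gates (F i)) (sub_own j)].
  have [mn|nsz] := ltnP (sz j) n'; first exact: none (Hcj j) mn.
  apply: (IH j _ _ _ _ _ (Hcj j) (Hsub j)).
  move=> _; apply: (toom_low_spec (pt := pt j) k0 _ _ (Hev j) (lab nm)).
    (* A sub-problem of size at least [n'] gives [n' * k <= 2 * m]; as [k] blocks cover [m] digits,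
       a block has at least [uphalf n'] digits. *)
    rewrite leq_uphalf_double; have [szk _] := Hsz j.
    have := ltn_ceil (m + k.-1)%N k0; nia.
  move=> x; have [da db _] := implements_digits x H.
  by have [da' db' _] := implements_digits x (Hsub j).
have [I /fin_all_exists[F HF]] := fin_all_exists Hj.
have sumI (w : forall j, I j -> nat) :
  (\sum_(z : {j : 'I_(toom_branches k) & I j}) w (tag z) (tagged z) = \sum_j \sum_i w j i)%N.
  by rewrite (@sig_big_dep _ _ _ _ I xpredT (fun _ => xpredT) w).
exists {j : 'I_(toom_branches k) & I j}, (fun z => F (tag z) (tagged z)); split.
- by case=> j i; have [+ _ _ _] := HF j; apply.
- rewrite card_tagged sumnE big_map big_enum /= /nu /= (negbTE nsmall) andbF add0n -big_split /=.
  by apply: eq_bigr => j _; have [_ -> _ _] := HF j.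
- rewrite (sumI (fun j i => is_standard (F j i) : nat)) /=.
  by apply: eq_bigr => j _; have [_ _ -> _] := HF j.
- move=> w; rewrite (sumI (fun j i => \sum_(g in own_gates (F j i)) w g)%N).
  apply: (@leq_trans (\sum_j \sum_(g in sub_own j) w g)%N).
    by apply: leq_sum => j _; have [_ _ _] := HF j; apply.
  rewrite -big_enum sum_flatten ownE /=.
  have -> : (\sum_(g in [set g in EA ++ EB ++ RC ++ flatten [seq enum (sub_own j) | j : 'I_(toom_branches k)]]) w g =
    \sum_(g <- EA ++ EB ++ RC ++ flatten [seq enum (sub_own j) | j : 'I_(toom_branches k)]) w g)%N.
    by rewrite big_uniq //=; apply: eq_bigl => g; rewrite inE.
  by rewrite !big_cat /= !addnA leq_addl.
Qed.

End Dag.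

(** * Counting inputs that are determined by bounded values *)

(** Induction on [r]: splitting [A] by the value at the head leaves fibers determined by the tail,
    and a value of magnitude below [K = s ^ w v] has fewer than [2 * K <= K ^ 2] possibilities. *)
Lemma card_determined (X V : finType) (s : nat) (A : {set X}) (r : seq V)
    (F : X -> V -> int) (w : V -> nat) :
  (2 <= s)%N ->
  (forall v, v \in r -> (0 < w v)%N /\ forall z, `|F z v| < (s ^ w v)%N%:Z) ->
  (forall z z', z \in A -> z' \in A -> (forall v, v \in r -> F z v = F z' v) -> z = z') ->
  (#|A| <= s ^ (2 * \sum_(v <- r) w v))%N.
Proof.
move=> s2; elim: r A => [|v r IH] A bnd inj.
  rewrite big_nil muln0 expn0 leqNgt; apply/negP => /card_gt1P[z [z' [zA z'A]]].
  by rewrite (inj z z') ?eqxx.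
have [w0 Fv] := bnd v (mem_head v r).
set K := (s ^ w v)%N in Fv.
have K1 : (1 < K)%N by rewrite -(exp1n (w v)) ltn_exp2r.
(* Non-negative values code themselves, negative ones are shifted by [K]; the bound is written as a
   successor for [inord]. *)
pose enc z : 'I_(K + K).-1.+1 := inord (if 0 <= F z v then `|F z v|%N else (K + `|F z v|)%N).
have encE z : enc z = (if 0 <= F z v then `|F z v|%N else (K + `|F z v|)%N) :> nat.
  by rewrite inordK //; have := Fv z; case: ifP => _; lia.
have fiber (k : 'I_(K + K).-1.+1) : (#|[set z in A | enc z == k]| <= s ^ (2 * \sum_(v <- r) w v))%N.
  apply: IH => [u ur|z z']; first by apply: bnd; rewrite inE ur orbT.
  rewrite !inE => /andP[zA /eqP zk] /andP[z'A /eqP z'k] E; apply: inj => // u.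
  rewrite inE => /orP[/eqP->|/E//].
  have : enc z = enc z' :> nat by rewrite zk z'k.
  by rewrite !encE; have := Fv z; have := Fv z'; do 2 case: ifP => ?; lia.
rewrite big_cons mulnDr expnD -sum1_card (partition_big enc xpredT) //=.
apply: (@leq_trans (\sum_(k < (K + K).-1.+1) s ^ (2 * \sum_(v <- r) w v))%N).
  by apply: leq_sum => k _; rewrite sum1dep_card; exact: fiber.
rewrite sum_nat_const card_ord prednK ?leq_mul2r; last lia.
apply/orP; right.
by rewrite mul2n -addnn expnD -/K; nia.
Qed.

(** * Data movement in an execution *)

Section Execution.
Variables (s n : nat) (G : cdag n) (P Bm : nat).
Variables (init : 'I_P -> {set ('I_n + 'I_n)}).
Implicit Types (es : seq (event G P)) (p q : 'I_P) (g : gate G) (v u : vertex G).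

Definition computes p g es :=
  has (fun e => if e is Compute q h then (q == p) && (h == g) else false) es.

(** Sent and received words form one set: repeated transfers of a word count once, which still
    bounds the messages from below. *)
Definition moved p es : {set word G} :=
  [set w | has (fun e => if e is Message src dst ws
                         then ((p == src) || (p == dst)) && (w \in ws)
                         else false) es].

Definition memory_after es : memory G P :=
  foldl (@step n G P) (initial_memory G init) es.

Lemma run_rcons mem es e : run Bm mem (rcons es e) <->
  run Bm mem es /\ enabled Bm (foldl (@step n G P) mem es) e.
Proof.
elim: es mem => [|e' es IH] mem /=; first by split=> [[]|[]].
by split=> [[? /IH[]]|[[? ?] ?]] //; split=> //; apply/IH.
Qed.

Lemma card_moved p mem es :
  run Bm mem es -> (#|moved p es| <= Bm * messages p es)%N.
Proof.
elim: es mem => [|e es IH] mem.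
  by move=> _; rewrite (_ : moved p [::] = set0) ?cards0 //; apply/setP=> w; rewrite !inE.
case=> en /IH{IH} le; rewrite /messages /= -/(messages p es) mulnDr.
set W : {set word G} := if e is Message src dst ws then
  if (p == src) || (p == dst) then ws else set0 else set0.
have -> : moved p (e :: es) = W :|: moved p es.
  apply/setP=> w; rewrite !inE /W; case: e {en W} => [q g|src dst ws] /=.
    by rewrite inE.
  by case: ifP => //=; rewrite inE.
apply: leq_trans (leq_card_setU _ _) _; rewrite leq_add //.
rewrite /W; case: e en {W} => [q g|src dst ws] /=; first by rewrite cards0.
by case=> _ wsB; case: ifP; rewrite ?cards0 // muln1.
Qed.

Lemma mem_origin es p w : w \in memory_after es p ->
  [\/ w \in initial_memory G init p, w \in moved p es
    | exists2 g, tag w = gate_vertex g & computes p g es].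
Proof.
elim/last_ind: es => [|es e IH]; first by constructor 1.
rewrite /memory_after foldl_rcons -/(memory_after es).
have old : w \in memory_after es p ->
  [\/ w \in initial_memory G init p, w \in moved p (rcons es e)
    | exists2 g, tag w = gate_vertex g & computes p g (rcons es e)].
  case/IH=> [|wm|[g tg cg]]; first by constructor 1.
    by constructor 2; move: wm; rewrite !inE has_rcons => ->; rewrite orbT.
  by constructor 3; exists g => //; rewrite /computes has_rcons -/(computes p g es) cg orbT.
case: e old => [q g|src dst ws] old /=.
  case: eqP => [Ep|_]; last exact: old.
  rewrite inE => /orP[/old//|]; rewrite inE => /eqP tg.
  by constructor 3; exists g => //; rewrite /computes has_rcons Ep !eqxx.
case: eqP => [Ep|_]; last exact: old.
rewrite inE => /orP[/old//|wws].
by constructor 2; rewrite inE has_rcons Ep eqxx orbT wws.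
Qed.

Lemma memory_mono es e p : memory_after es p \subset memory_after (rcons es e) p.
Proof.
rewrite /memory_after foldl_rcons; case: e => [q g|src dst ws] /=;
  by case: ifP => _ //; rewrite subsetUl.
Qed.

Lemma holds_mono es e p v :
  holds (memory_after es) p v -> holds (memory_after (rcons es e)) p v.
Proof. by move=> hv w /hv; apply: (subsetP (memory_mono _ _ _)). Qed.

Lemma computes_operands es p g u :
  run Bm (initial_memory G init) es -> computes p g es -> u \in operands g ->
  holds (memory_after es) p u.
Proof.
elim/last_ind: es => // es e IH /run_rcons[re en].
rewrite /computes has_rcons => /orP[|cg ug]; last exact/holds_mono/IH.
case: e en => // q h /= en /andP[/eqP <- /eqP <-] /en.
exact: holds_mono.
Qed.

Definition touches (Gamma : {set gate G}) p es :=
  [exists w in moved p es, inside Gamma (tag w)].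

Lemma computes_rcons es e p g : computes p g es -> computes p g (rcons es e).
Proof. by rewrite /computes has_rcons => ->; rewrite orbT. Qed.

Lemma touches_rcons es e p Gamma : touches Gamma p es -> touches Gamma p (rcons es e).
Proof.
case/exists_inP => w wm iw; apply/exists_inP; exists w => //.
by move: wm; rewrite !inE has_rcons => ->; rewrite orbT.
Qed.

(* A gate obtained by [p] comes from a processor that moved a word of it; following
   the senders back in time ends at the processors that computed the summands. *)
Lemma summand_origin es p (t : sumtree G) (Gamma : {set gate G}) w g :
  (forall h : gate G, 0 < gate_words h)%N ->
  run Bm (initial_memory G init) es -> sumtree_wf t ->
  {subset tree_gates t <= Gamma} ->
  w \in memory_after es p -> tag w = gate_vertex (Defs.root t) ->
  g \in map snd (terms t) ->
  computes p g es \/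
  touches Gamma p es /\ exists2 q, touches Gamma q es & computes q g es.
Proof.
move=> gw; elim/last_ind: es p t w => [|es e IH] p t w.
  by move=> _ _ _; rewrite /memory_after /= inE => + tw; rewrite tw.
move=> /run_rcons[re en] wf tG + tw gt.
rewrite /memory_after foldl_rcons -/(memory_after es).
have lift p' : computes p' g es \/ (touches Gamma p' es /\
    exists2 q, touches Gamma q es & computes q g es) ->
  computes p' g (rcons es e) \/ (touches Gamma p' (rcons es e) /\
    exists2 q, touches Gamma q (rcons es e) & computes q g (rcons es e)).
  case=> [cg|[tp [q tq cq]]]; [left|right].
    exact: computes_rcons.
  by split; [|exists q]; rewrite ?touches_rcons ?computes_rcons.
have old : w \in memory_after es p -> computes p g (rcons es e) \/
  (touches Gamma p (rcons es e) /\
    exists2 q, touches Gamma q (rcons es e) & computes q g (rcons es e)).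
  by move=> wm; apply/lift/(IH p t w).
case: e en old lift => [q h|src dst ws] en old lift.
  rewrite /=; case: eqP => [Ep|_]; last exact: old.
  rewrite inE => /orP[/old//|].
  rewrite inE => /eqP; rewrite tw => -[hE].
  (* A leaf has just been computed by [p]. At an inner node [p] held both children one event
     earlier, and the descent continues in the child that contains [g]. *)
  case: t wf tG tw gt hE {old} => [l|l neg t1 t2] wf tG tw gt hE.
    left; move: gt; rewrite /= inE => /eqP ->.
    by rewrite /computes has_rcons Ep (hE : l = h) !eqxx.
  have [opE _ wf1 wf2] := wf.
  have Hsub t' : (t' = t1) \/ (t' = t2) -> [/\ sumtree_wf t', {subset tree_gates t' <= Gamma}
      & gate_vertex (Defs.root t') \in operands h].
    rewrite -hE opE /=; case=> ->; split=> //; rewrite ?inE ?eqxx ?orbT //.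
    - by move=> z zt; apply: tG; rewrite tree_gatesNode inE mem_cat zt orbT.
    - by move=> z zt; apply: tG; rewrite tree_gatesNode inE mem_cat zt !orbT.
  have [t' Ht' gt'] : exists2 t', (t' = t1) \/ (t' = t2) & g \in map snd (terms t').
    move: gt; rewrite /= map_cat mem_cat -map_comp (eq_map (g := snd)) //.
    by case/orP=> ?; [exists t1|exists t2]; auto.
  have [wf' tG' rt'] := Hsub _ Ht'.
  pose w' : word G := Tagged (fun v => 'I_(words v)) (Ordinal (gw (Defs.root t')) : 'I_(words (gate_vertex (Defs.root t')))).
  apply/lift/(IH p t' w') => //.
  by rewrite Ep; apply: (en _ rt').
rewrite /=; case: eqP => [Ep|_]; last exact: old.
rewrite inE => /orP[/old//|wws].
have tch r : (r == src) || (r == dst) -> touches Gamma r (rcons es (Message src dst ws)).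
  move=> rr; apply/exists_inP; exists w; first by rewrite inE has_rcons rr wws.
  by rewrite tw /=; apply: tG; exact: root_tree_gates.
have [ss _] := en.
(* The sender held [w] one event earlier and touches [Gamma] by sending it, so either outcome for
   the sender provides a suitable [q]. *)
have := IH src t w re wf tG (subsetP ss w wws) tw gt.
case/lift => [cs|[_ Hq]]; right; split=> //; rewrite ?tch ?Ep ?eqxx ?orbT //.
by exists src => //; apply: tch; rewrite eqxx.
Qed.

End Execution.

(** * Information carried by the moved words *)

Section Information.
Variables (s n : nat) (G : cdag n) (P Bm : nat).
Variables (init : 'I_P -> {set ('I_n + 'I_n)}) (es : seq (event G P)).
Implicit Types (p q : 'I_P) (g : gate G) (v u : vertex G) (x y : inputs s n).
Hypotheses (s2 : (2 <= s)%N) (wf : cdag_wf s G).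
Hypothesis run_es : run Bm (initial_memory G init) es.

Lemma words_gt0 v : (0 < words v)%N.
Proof. by case: v => //= g; case: wf => _ /(_ g)[]. Qed.

Definition first_word v : word G := Tagged (fun v => 'I_(words v)) (Ordinal (words_gt0 v)).

(** If some word of a held result never moved, [p] had the result initially or computed it;
    otherwise all its words can be charged to [p]. *)
Definition moved_whole p v := [forall w, (tag w == v) ==> (w \in moved p es)].

(** * Values fixed by what enters a region of the DAG *)

Section Determined.
Variables (p : 'I_P) (S : pred (vertex G)) (x y : inputs s n).
Hypothesis outer : forall g u, S (gate_vertex g) -> u \in operands g -> ~~ S u ->
  holds (memory_after init es) p u -> value x u = value y u.
Hypothesis inner_moved : forall v, S v -> moved_whole p v -> value x v = value y v.
Hypothesis inner_init : forall i, S (inl i) -> i \in init p ->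
  value x (inl i : vertex G) = value y (inl i : vertex G).

Lemma determined_holds v :
  (forall g, v = gate_vertex g -> computes p g es -> value x v = value y v) ->
  S v -> holds (memory_after init es) p v -> value x v = value y v.
Proof.
move=> Hc Sv hv.
have [/exists_inP[w wi /eqP tw]|ni] := boolP [exists w in initial_memory G init p, tag w == v].
  by move: wi; rewrite inE tw; case: v Sv {Hc hv tw} => // i Si; exact: inner_init.
have [mv|/forallPn[w]] := boolP (moved_whole p v); first exact: inner_moved.
rewrite negb_imply => /andP[/eqP tw nm].
case: (mem_origin (hv w tw)) => [wi|wm|[g tg cg]].
- have /exists_inP[] := ni.
  by exists w; rewrite ?tw.
- by rewrite wm in nm.
- by apply: Hc cg; rewrite -tw tg.
Qed.

(** Induction on the level: an operand outside [S] agrees by [outer]; one inside [S] was moved, was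
    present initially, or was computed by [p] and has a lower level. *)
Lemma determined_computes g :
  S (gate_vertex g) -> computes p g es ->
  value x (gate_vertex g) = value y (gate_vertex g).
Proof.
have [d ld] := ubnP (level g); elim: d g ld => // d IH g ld Sg cg.
rewrite !value_gate //; congr op; apply/eq_in_map => u ug.
have hu := computes_operands run_es cg ug.
have [Su|nSu] := boolP (S u); last exact: outer Sg ug nSu hu.
apply: determined_holds => // h Eu ch; rewrite Eu; apply: IH => //; last by rewrite -Eu.
have /leq_trans -> // : (level h < level g)%N by case: wf => /(_ g h) + _; apply; rewrite -Eu.
Qed.

Lemma determined v : S v -> holds (memory_after init es) p v -> value x v = value y v.
Proof.
move=> Sv hv; apply: determined_holds => // g Ev cg.
by rewrite Ev; apply: determined_computes => //; rewrite -Ev.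
Qed.

End Determined.

Lemma card_words v : #|[set w : word G | tag w == v]| = words v.
Proof.
have inj v' : injective (fun i : 'I_(words v') => Tagged (fun v => 'I_(words v)) i : word G).
  by move=> i j /eqP; rewrite eq_Tagged => /eqP.
rewrite -[RHS]card_ord -(card_imset predT (inj v)); apply: eq_card => w.
rewrite inE; apply/eqP/imsetP => [<-|[i _ ->]//].
by exists (tagged w) => //; case: w.
Qed.

Lemma sum_words p (S : pred (vertex G)) :
  (\sum_(v | S v && moved_whole p v) words v <= #|[set w in moved p es | S (tag w)]|)%N.
Proof.
rewrite -sum1_card (partition_big (fun w => tag w) S) /=; last by move=> w; rewrite inE => /andP[].
rewrite big_mkcondr /=; apply: leq_sum => v Sv; case: ifP => // /forallP mv.
rewrite -card_words -sum1_card; apply: eq_leq; apply: eq_bigl => w; rewrite !inE.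
case tw: (tag w == v); rewrite ?andbF // andbT.
by have := mv w; rewrite tw inE /= => ->; rewrite (eqP tw) Sv.
Qed.

(* The factor 2 is due to signs, which are not charged for: a value kept in w words
   takes up to 2 s^w - 1 <= s^(2w) values. *)
Lemma card_free_digits p (S : pred (vertex G)) (E : {set 'I_n}) (o0 : 'I_s)
    (b : 'I_n -> 'I_s) :
  (forall z z' : {ffun 'I_n -> 'I_s},
    (forall i, i \notin E -> z i = o0) -> (forall i, i \notin E -> z' i = o0) ->
    (forall v, S v -> moved_whole p v ->
      value (z : 'I_n -> 'I_s, b) v = value (z' : 'I_n -> 'I_s, b) v) ->
    z = z') ->
  (#|E| <= 2 * #|[set w in moved p es | S (tag w)]|)%N.
Proof.
move=> inj.
(* [A] consists of the digit functions equal to [o0] outside [E]; it has [s ^ #|E|] elements, so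
   exponents can be compared. *)
pose A := [set z in pffun_on o0 (mem E) predT].
have AE z : z \in A -> forall i, i \notin E -> z i = o0.
  rewrite inE => /pffun_onP[/supportP zE _] i iE; exact: zE.
have cA : #|A| = (s ^ #|E|)%N.
  by rewrite cardsE card_pffun_on cardT size_enum_ord.
apply: (@leq_trans (2 * \sum_(v <- enum [pred v | S v && moved_whole p v]) words v)); last first.
  by rewrite leq_mul2l big_enum sum_words orbT.
rewrite -(leq_exp2l _ _ s2) -cA.
pose F (z : {ffun 'I_n -> 'I_s}) (v : vertex G) := value (z : 'I_n -> 'I_s, b) v.
apply: (@card_determined _ _ _ A _ F (@words n G) s2).
  move=> v _; split; first exact: words_gt0.
  move=> z; case: v => [[i|i]|g] /=.
  - by rewrite expn1 /value /= ger0_norm // ltz_nat.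
  - by rewrite expn1 /value /= ger0_norm // ltz_nat.
  - by case: wf => _ /(_ g)[_]; apply.
move=> z z' /AE zE /AE z'E Ev; apply: inj => // v Sv mv.
by apply: Ev; rewrite mem_enum inE Sv.
Qed.

(** * Inputs and outputs of one maximal sub-problem at one processor *)

Section Subproblem.
Variables (N : nat) (v0 : vertex G) (g0 : gate G) (M : msp G).
Hypothesis MP : msp_spec s N v0 M.

Definition holdsb p v := [forall w, (tag w == v) ==> (w \in memory_after init es p)].

Lemma holdsP p v : reflect (holds (memory_after init es) p v) (holdsb p v).
Proof.
apply: (iffP forallP) => [hv w tw|hv w]; first by have := hv w; rewrite tw eqxx.
by apply/implyP => /eqP/hv.
Qed.

Definition held p : {set 'I_n} := [set i : 'I_n | (i < N)%N && holdsb p (nth v0 (ina M) i)].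

Lemma value_ina x i : low N x ->
  [seq value x v | v <- ina M]`_i = [seq value x v | v <- digits_A G]`_i.
Proof.
move=> lx; have [/(_ x)[da _ _ _] /(_ x lx)[E _] _ _ _] := MP.
by apply: dnum_inj da (digits_digits_A G x) _ _; rewrite -!numE.
Qed.

Lemma value_inb x i : low N x ->
  [seq value x v | v <- inb M]`_i = [seq value x v | v <- digits_B G]`_i.
Proof.
move=> lx; have [/(_ x)[_ db _ _] /(_ x lx)[_ E] _ _ _] := MP.
by apply: dnum_inj db (digits_digits_B G x) _ _; rewrite -!numE.
Qed.

(** The input B is [s ^ b], so the outputs and the digits of A shifted by [b] places represent the
    same number, and digits are unique. *)
Lemma value_out x (b : 'I_n) i : low N x -> (forall j, x.2 j = (j == b) :> nat) ->
  [seq value x (gate_vertex g) | g <- out M]`_(i + b) =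
  [seq value x v | v <- digits_A G]`_i.
Proof.
move=> lx xb; have [/(_ x)[_ _ dc E] /(_ x lx)[EA EB] _ _ _] := MP.
have s0 : 0 < s%:Z by rewrite ltz_nat; apply: leq_trans s2.
have EBb : num x (digits_B G) = s%:Z ^+ b.
  transitivity (dnum s (nseq b 0 ++ [:: 1])); last first.
    by rewrite dnum_nseq0 /= mulr0 addr0 mulr1.
  rewrite numE; apply: eq_dnum => j.
  rewrite value_digits_B nth_cat nth_nseq size_nseq if_same.
  case: insubP => [o _ <-|nj] /=; last first.
    case: ltnP => // bj; case jb: (j - b)%N => [|[|]] //.
    by move: nj (ltn_ord b); rewrite -leqNgt; lia.
  rewrite xb; case: ltnP => bo; first by rewrite (negbTE (_ : o != b)) // neq_ltn bo.
  case ob: (o - b)%N => [|k] /=.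
    by rewrite (_ : o == b) //; apply/eqP/val_inj/eqP; rewrite eqn_leq bo -subn_eq0 ob.
  by rewrite nth_nil (negbTE (_ : o != b)) //; apply: contra_eqN ob => /eqP->; rewrite subnn.
have -> : [seq value x v | v <- digits_A G]`_i =
    (nseq b 0 ++ [seq value x v | v <- digits_A G])`_(i + b).
  by rewrite nth_cat size_nseq ltnNge leq_addl /= addnK.
apply: (dnum_inj dc).
  rewrite /digits all_cat; apply/andP; split; last exact: digits_digits_A.
  by apply/allP => d /nseqP[-> _]; rewrite lexx.
rewrite dnum_nseq0 -numE -EBb mulrC -EA -EB -E numE /dnum; congr foldr.
by rewrite -map_comp.
Qed.

Let zero_digit : 'I_s := Ordinal (ltnW s2).
Let one_digit : 'I_s := Ordinal s2.

Lemma low_free (E : {set 'I_n}) (z : {ffun 'I_n -> 'I_s}) (b : 'I_n -> 'I_s) :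
  (forall i, i \in E -> (i < N)%N) -> (forall i, i \notin E -> z i = zero_digit) ->
  (forall i : 'I_n, (N <= i)%N -> b i = 0 :> nat) -> low N (z : 'I_n -> 'I_s, b).
Proof.
move=> EN zE b0 i Ni; split; last exact: b0.
by rewrite /= zE //; apply/negP => /EN; rewrite ltnNge Ni.
Qed.

(** The region is the whole DAG and B is 0. Digits held in [M] but not initially present are free
    and all others are 0; the initial digits are then constant, and the moved words must determine
    the free ones. *)
Lemma card_held p :
  (#|held p| <= #|[set i : 'I_n | inl i \in init p]| + 2 * #|moved p es|)%N.
Proof.
set D := [set i | _]; rewrite -(cardsID D (held p)) leq_add ?subset_leq_card ?subsetIr //.
set E := held p :\: D.
have -> : moved p es = [set w in moved p es | predT (tag w)].
  by apply/setP=> w; rewrite [in RHS]inE andbT.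
have EN i : i \in E -> (i < N)%N by rewrite !inE => /andP[_ /andP[]].
apply: (@card_free_digits p predT E zero_digit (fun _ => zero_digit)).
move=> z z' zE z'E mv; apply/ffunP => i.
have [iE|niE] := boolP (i \in E); last by rewrite zE // z'E.
have lz := low_free EN zE (b := fun=> zero_digit) (fun _ _ => erefl).
have lz' := low_free EN z'E (b := fun=> zero_digit) (fun _ _ => erefl).
apply: val_inj; apply/eqP; rewrite -eqz_nat; apply/eqP.
have hv : holds (memory_after init es) p (nth v0 (ina M) i).
  by apply/holdsP; move: iE; rewrite !inE => /andP[_ /andP[]].
have := determined (S := predT) (x := (z : 'I_n -> 'I_s, fun=> zero_digit))
  (y := (z' : 'I_n -> 'I_s, fun=> zero_digit)) _ mv _ isT hv.
have := value_ina i lz; have := value_ina i lz'.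
rewrite !value_digits_A valK /=.
have [iM|Mi] := ltnP i (size (ina M)); last by rewrite !nth_default ?size_map // => <- <-.
rewrite !(nth_map v0) // => -> -> -> // [j|j] // _ jp.
have jE : j \notin E by rewrite !inE jp.
by rewrite /value /= zE // z'E.
Qed.

(** The region is the gate set of [M] and B is [s ^ b]. The free digits reappear as outputs that [p]
    computes, while the inputs of [M] that [p] holds have fixed values; so moved words of the gates
    of [M] must determine the free digits. *)
Lemma card_foreign p (b : 'I_n) : (b < N)%N ->
  (#|[set e : 'I_n | [&& (e < N)%N, e \notin held p
       & computes p (nth g0 (out M) (e + b)) es]]|
   <= 2 * #|[set w in moved p es | inside (own_gates M) (tag w)]|)%N.
Proof.
move=> bN; set E := [set e : 'I_n | _].
pose B j := if j == b then one_digit else zero_digit.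
have EN i : i \in E -> (i < N)%N by rewrite inE => /and3P[].
apply: (@card_free_digits p (inside (own_gates M)) E zero_digit B).
move=> z z' zE z'E mv; apply/ffunP => i.
have [iE|niE] := boolP (i \in E); last by rewrite zE // z'E.
have B0 (j : 'I_n) : (N <= j)%N -> B j = 0 :> nat.
  by rewrite /B; case: eqP => // ->; rewrite leqNgt bN.
have Bb j : B j = (j == b) :> nat by rewrite /B; case: eqP.
have lz := low_free EN zE B0; have lz' := low_free EN z'E B0.
have [_ _ closed [outown sz] _] := MP.
have /and3P[iN inh ci] : [&& (i < N)%N, i \notin held p & computes p (nth g0 (out M) (i + b)) es].
  by move: iE; rewrite inE.
have ib : (i + b < size (out M))%N.
  by apply: leq_trans sz; rewrite -addnn -addSn leq_add // ltnW.
apply: val_inj; apply/eqP; rewrite -eqz_nat; apply/eqP.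
have := determined_computes (S := inside (own_gates M))
  (x := (z : 'I_n -> 'I_s, B)) (y := (z' : 'I_n -> 'I_s, B)) _ mv _ (outown _ (mem_nth g0 ib)) ci.
have := value_out i lz Bb; have := value_out i lz' Bb.
rewrite !value_digits_A valK /= !(nth_map g0) // => -> -> -> // g u gM ug uM hu.
have := closed _ _ gM ug; rewrite (negbTE uM) orbF => /orP[]/(nthP v0)[k ks ku].
- have E1 x : value x u = [seq value x v | v <- ina M]`_k by rewrite (nth_map v0) ?ku.
  rewrite !E1 !value_ina // !value_digits_A.
  case: insubP => //= o _ ok; congr (Posz (nat_of_ord _)).
  suff oE : o \notin E by rewrite zE // z'E.
  apply/negP; rewrite inE => /and3P[oN /negP + _]; apply.
  by rewrite inE oN ok ku; apply/holdsP.
- have E1 x : value x u = [seq value x v | v <- inb M]`_k by rewrite (nth_map v0) ?ku.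
  by rewrite !E1 !value_inb // !value_digits_B.
Qed.

End Subproblem.

Lemma computes_holds p g : computes p g es ->
  holds (memory_after init es) p (gate_vertex g).
Proof.
elim/last_ind: es => // es' e IH; rewrite /computes has_rcons => /orP[|/IH]; last first.
  exact: holds_mono.
case: e => // q h /andP[/eqP-> /eqP->] w tw.
by rewrite /memory_after foldl_rcons /= eqxx !inE tw eqxx orbT.
Qed.

(** The packing inequality is applied with each gate weighted by the number of its words in [A]. *)
Lemma packs_words (T : Type) (r : seq T) (S : T -> {set gate G}) own (A : {set word G}) :
  packs r S own ->
  (\sum_(M <- r) #|[set w in A | inside (S M) (tag w)]| <=
     #|[set w in A | inside own (tag w)]|)%N.
Proof.
move=> pk.
have E (own' : {set gate G}) : #|[set w in A | inside own' (tag w)]| =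
    (\sum_(g in own') #|[set w in A | tag w == gate_vertex g]|)%N.
  rewrite -sum1_card (eq_bigr (fun g => \sum_(w in A | tag w == gate_vertex g) 1)%N); last first.
    by move=> g _; rewrite -sum1_card; apply: eq_bigl => w; rewrite inE.
  rewrite (exchange_big_dep (fun w => (w \in A) && inside own' (tag w))) /=; last first.
    by move=> g w gO /andP[-> /eqP->].
  rewrite (eq_bigl (fun w => (w \in A) && inside own' (tag w))); last first.
    by move=> w; rewrite inE.
  apply: eq_bigr => w /andP[wA]; case tw: (tag w) => [i|g] //= gO.
  rewrite (big_pred1 g) // => h; rewrite wA /=.
  case: eqVneq => [[<-]|ne]; first by rewrite gO eqxx.
  by rewrite andbF; apply/esym/eqP => hg; rewrite hg eqxx in ne.
rewrite E; apply: leq_trans (pk _); apply: eq_leq; apply: eq_bigr => M _; exact: E.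
Qed.

(** * Counting *)

Section Family.
Variables (N : nat) (v0 : vertex G) (g0 : gate G) (I : finType) (F : I -> msp G).
Variables (W m0 : nat).
Hypothesis F_spec : forall i, msp_spec s N v0 (F i).
Hypothesis F_packs : packs (index_enum I) (fun i => own_gates (F i)) [set: gate G].
Hypothesis Nn : (N <= n)%N.
Hypothesis all_computed : forall g, exists p, computes p g es.
Hypothesis moved_le : forall p, (#|moved p es| <= W)%N.
Hypothesis init_le : forall p, (#|[set i : 'I_n | inl i \in init p]| <= m0)%N.

Let own_moved p i := #|[set w in moved p es | inside (own_gates (F i)) (tag w)]|.

Lemma sum_own_moved p : (\sum_i own_moved p i <= W)%N.
Proof.
apply: leq_trans (packs_words _ F_packs) _; apply: leq_trans (moved_le p).
by apply/subset_leq_card/subsetP => w; rewrite inE => /andP[].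
Qed.

Lemma held_le p i : (#|held N v0 (F i) p| <= m0 + 2 * W)%N.
Proof.
by apply: leq_trans (card_held (F_spec i) p) _; rewrite leq_add // leq_mul2l moved_le orbT.
Qed.

(** Reindexed by [t = e + b], which is below [N.*2], the pairs for one [t] count distinct members of
    [H t]. *)
Lemma sum_shifts (H : nat -> {set 'I_n}) K : (forall t, #|H t| <= K)%N ->
  (\sum_(b < n | (b < N)%N) \sum_(e < n | (e < N)%N) (e \in H (e + b)%N) <= N.*2 * K)%N.
Proof.
move=> HK; rewrite exchange_big /=.
apply: (@leq_trans (\sum_(e < n) \sum_(0 <= t < N.*2) (e \in H t))%N).
  rewrite big_mkcond /=; apply: leq_sum => e _; case: ifP => // eN.
  rewrite -(big_ord_widen n (fun b => (e \in H (e + b)%N) : nat) Nn).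
  rewrite -(big_mkord xpredT (fun b => (e \in H (e + b)%N) : nat)).
  have -> : (\sum_(0 <= b < N) (e \in H (e + b)%N) = \sum_(e <= t < N + e) (e \in H t))%N.
    transitivity (\sum_(0 + e <= t < N + e) (e \in H t))%N; last by rewrite add0n.
    by rewrite big_addn addnK; apply: eq_bigr => b _; rewrite addnC.
  have eN2 : (N + e <= N.*2)%N by rewrite -addnn leq_add2l ltnW.
  rewrite (big_cat_nat (leq0n e) (leq_trans (leq_addl N e) eN2)) /=.
  rewrite (big_cat_nat (leq_addl N e) eN2) /=.
  by rewrite addnCA leq_addr.
rewrite exchange_big big_mkord /=.
apply: (@leq_trans (\sum_(t < N.*2) K)%N); last by rewrite sum_nat_const card_ord.
apply: leq_sum => t _; apply: leq_trans (HK t).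
rewrite -sum1_card [X in (_ <= X)%N]big_mkcond /=.
by apply: leq_sum => e _; case: (e \in _).
Qed.

Lemma card_lt_N : (\sum_(b < n | (b < N)%N) 1 = N)%N.
Proof. by rewrite -(big_ord_widen n (fun=> 1%N) Nn) sum_nat_const card_ord muln1. Qed.

Lemma output_words : (#|I| * N <= 2 * P * W + 2 * #|I| * (m0 + 2 * W))%N.
Proof.
have [->|N0] := posnP N; first by rewrite muln0.
(* Recomputation may provide several computing processors; one is chosen per gate. *)
have [pc pcP] := fin_all_exists all_computed.
pose H i t := held N v0 (F i) (pc (nth g0 (out (F i)) t)).
(* A pair is bad if the processor chosen for output [e + b] holds digit [e]. Bad pairs are few
   because little is held; good pairs are charged to moved words through [card_foreign]. *)
pose bad i := (\sum_(b < n | (b < N)%N) \sum_(e < n | (e < N)%N) (e \in H i (e + b)%N))%N.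
pose good i := (\sum_(b < n | (b < N)%N) \sum_(e < n | (e < N)%N) (e \notin H i (e + b)%N))%N.
have split_pairs i : (N * N = bad i + good i)%N.
  rewrite -big_split /= -{1}card_lt_N big_distrl /=; apply: eq_bigr => b _.
  rewrite -big_split /= mul1n -{1}card_lt_N; apply: eq_bigr => e _.
  by case: (e \in _).
have bad_le i : (bad i <= N.*2 * (m0 + 2 * W))%N.
  by apply: sum_shifts => t; exact: held_le.
have good_le i : (good i <= \sum_(b < n | (b < N)%N) \sum_p 2 * own_moved p i)%N.
  apply: leq_sum => b bN.
  apply: (@leq_trans (\sum_p #|[set e : 'I_n | [&& (e < N)%N, e \notin held N v0 (F i) p
      & computes p (nth g0 (out (F i)) (e + b)) es]]|)%N); last first.
    by apply: leq_sum => p _; exact (card_foreign g0 (F_spec i) p bN).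
  rewrite (eq_bigr (fun p => \sum_(e < n | (e < N)%N) ((e \notin held N v0 (F i) p) &&
      computes p (nth g0 (out (F i)) (e + b)) es))%N); last first.
    move=> p _; rewrite -sum1_card [LHS]big_mkcond [RHS]big_mkcond /=.
    by apply: eq_bigr => e _; rewrite inE; case: ltnP => //=; case: (_ && _).
  rewrite exchange_big /=; apply: leq_sum => e _.
  rewrite (bigD1 (pc (nth g0 (out (F i)) (e + b)))) //= pcP andbT.
  exact: leq_addr.
(* For each of the [N] shifts, disjointness of the MSPs limits the charge of a processor to
   [2 * W]. *)
have sum_good : (\sum_i good i <= N * (2 * P * W))%N.
  apply: (@leq_trans (\sum_i \sum_(b < n | (b < N)%N) \sum_p 2 * own_moved p i)%N).
    by apply: leq_sum => i _; exact: good_le.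
  rewrite exchange_big /= -[X in (_ <= X * _)%N]card_lt_N big_distrl /=.
  apply: leq_sum => b _.
  rewrite exchange_big /= mul1n.
  apply: (@leq_trans (\sum_(p < P) 2 * W)%N).
    by apply: leq_sum => p _; rewrite -big_distrr /= leq_mul2l sum_own_moved orbT.
  by rewrite sum_nat_const card_ord mulnA (mulnC P).
have : (#|I| * (N * N) <= #|I| * (N.*2 * (m0 + 2 * W)) + N * (2 * P * W))%N.
  rewrite -sum_nat_const (eq_bigr _ (fun i _ => split_pairs i)) big_split /=.
  rewrite leq_add // -sum_nat_const; apply: leq_sum => i _; exact: bad_le.
by rewrite -muln2; nia.
Qed.

Lemma summand_words : (2 * (m0 + 2 * W) <= N)%N ->
  ((\sum_i is_standard (F i)) * (N * N) <= 4 * P * W * (m0 + 2 * W))%N.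
Proof.
move=> small; set K := (m0 + 2 * W)%N in small *.
have per i : (is_standard (F i) * (N * N) <= 4 * K * \sum_p own_moved p i)%N.
  case std: (is_standard (F i)); last by rewrite mul0n.
  have [_ _ _ _ /(_ std)[prod [tree [col [Htree Hpack Hprod]]]]] := F_spec i.
  (* If the processor [rho] computing the root moves no word of the column, it computes all [t.+1]
     products and holds as many digits of A, contradicting [K <= N./2 <= t]. *)
  have computer t j : (N./2 <= t < N)%N -> (j <= t)%N ->
      exists2 q, touches (col t) q es & computes q (prod j (t - j)%N) es.
    move=> /andP[Nt tN] jt.
    have [wft subt] := Htree t tN.
    have [rho crho] := all_computed (Defs.root (tree t)).
    have hrho := computes_holds crho.
    have gw (g : gate G) : (0 < gate_words g)%N by case: wf => _ /(_ g)[].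
    have origin j' : (j' <= t)%N -> computes rho (prod j' (t - j')%N) es \/
      touches (col t) rho es /\ exists2 q, touches (col t) q es & computes q (prod j' (t - j')%N) es.
      move=> j't; have [gt _] : prod j' (t - j')%N \in map snd (terms (tree t)) /\
         nth v0 (ina (F i)) j' \in operands (prod j' (t - j')%N) by apply: Hprod; rewrite j't.
      have rw := hrho (first_word (gate_vertex (Defs.root (tree t)))) erefl.
      exact: summand_origin gw run_es wft subt rw erefl gt.
    have [trho|ntrho] := boolP (touches (col t) rho es).
      by case: (origin j jt) => [cr|[_]//]; exists rho.
    have all_rho j' : (j' <= t)%N -> computes rho (prod j' (t - j')%N) es.
      by case/origin => // -[]; rewrite (negbTE ntrho).
    have : (\sum_(j' < n | (j' < t.+1)%N) 1 <= K)%N.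
      apply: leq_trans (held_le rho i); rewrite -sum1_card big_mkcond [X in (_ <= X)%N]big_mkcond /=.
      apply: leq_sum => j' _; case: ltnP => // j't; rewrite inE (leq_trans j't) //=.
      case: holdsP => // -[]; apply: (computes_operands run_es (all_rho j' j't)).
      by case: (Hprod j' t) => //; rewrite -ltnS j't.
    rewrite -(big_ord_widen n (fun=> 1%N)); last exact: leq_trans tN Nn.
    by rewrite sum_nat_const card_ord muln1; lia.
  (* Each product of the column is assigned to a processor that touches the column and computes it;
     such a processor holds at most [K] of the digits of A. *)
  have column t : (N./2 <= t < N)%N ->
      (t.+1 <= \sum_q touches (col t) q es * K)%N.
    move=> tN; have tN' : (t < N)%N by case/andP: tN.
    have -> : t.+1 = (\sum_(j < n | (j < t.+1)%N) 1)%N.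
      by rewrite -(big_ord_widen n (fun=> 1%N)) ?(leq_trans tN' Nn) // sum_nat_const card_ord muln1.
    apply: (@leq_trans (\sum_(j < n | (j < t.+1)%N) \sum_q
        (touches (col t) q es && (j \in held N v0 (F i) q)))%N).
      apply: leq_sum => j jt; have [q tq cq] := computer t j tN jt.
      rewrite (bigD1 q) //= tq inE (leq_trans jt) //=.
      case: holdsP => // -[]; apply: (computes_operands run_es cq).
      by case: (Hprod j t) => //; rewrite -ltnS jt.
    rewrite exchange_big /=; apply: leq_sum => q _; case: (touches _ _ _); last by rewrite big1.
    rewrite mul1n; apply: leq_trans (held_le q i); rewrite -sum1_card big_mkcond [X in (_ <= X)%N]big_mkcond /=.
    by apply: leq_sum => j _; case: ifP; case: (j \in _).
  (* Columns have disjoint gates, so different touched columns account for different moved words. *)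
  have touched q : (\sum_(t <- iota 0 N) touches (col t) q es <= own_moved q i)%N.
    apply: leq_trans (packs_words _ Hpack); apply: leq_sum => t _.
    case tq: (touches _ _ _) => //; rewrite card_gt0; apply/set0Pn.
    by case/exists_inP: tq => w wm iw; exists w; rewrite inE wm.
  rewrite mul1n.
  (* The range has [N - N./2] columns with at least [N./2 + 1] products each, hence at least a
     quarter of [N * N] products. *)
  apply: (@leq_trans (4 * \sum_(t < N | (N./2 <= t)%N) t.+1)).
    apply: (@leq_trans (4 * \sum_(t < N | (N./2 <= t)%N) (N./2).+1)).
      rewrite -(big_geq_mkord N./2 N xpredT (fun=> (N./2).+1)) sum_nat_const_nat; nia.
    by rewrite leq_mul2l; apply: leq_sum.
  rewrite -mulnA leq_mul2l /=.
  apply: (@leq_trans (\sum_(t < N) \sum_q touches (col t) q es * K)).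
    rewrite big_mkcond; apply: leq_sum => t _ /=; case: ifP => // Nt.
    by apply: column; rewrite Nt ltn_ord.
  rewrite exchange_big /= big_distrr /=; apply: leq_sum => q _.
  rewrite -big_distrl /= mulnC leq_mul2l; apply/orP; right.
  by apply: leq_trans (touched q); rewrite -[X in iota 0 X]subn0 -/(index_iota 0 N) big_mkord.
rewrite big_distrl /=; apply: (@leq_trans (\sum_i 4 * K * \sum_p own_moved p i)%N).
  by apply: leq_sum => i _; exact: per.
rewrite -big_distrr /= exchange_big /=.
apply: (@leq_trans (4 * K * \sum_(p < P) W)%N).
  by rewrite leq_mul2l; apply/orP; right; apply: leq_sum => p _; exact: sum_own_moved.
by rewrite sum_nat_const card_ord; nia.
Qed.

End Family.

End Information.

(** * Combining the two inequalities over the reals *)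

(** If [N < 2 * (m0 + 2 * W)], the cap [1 / 4] suffices. If [nu / P >= 1 / 4], the output inequality
    gives [N / 2 <= mu + 6 * W], the source of the constant 6. Otherwise both inequalities together
    give [mu + 5 * W]. *)
Lemma words_lower_bound (R : realType) (N n' P W m0 nu nu1 : nat) (mu : R) :
  (0 < P)%N -> (n' <= 2 * N)%N -> (nu1 <= nu)%N -> m0%:R <= mu ->
  (nu * N <= 2 * P * W + 2 * nu * (m0 + 2 * W))%N ->
  ((2 * (m0 + 2 * W) <= N)%N -> (nu1 * (N * N) <= 4 * P * W * (m0 + 2 * W))%N) ->
  n'%:R * Num.min (1 / 4)
    (Num.sqrt (nu1%:R / (8 * P%:R)) + nu%:R / (2 * P%:R)) - mu <= 6 * W%:R.
Proof.
move=> P0 n'N nu1nu m0mu outs sums.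
have p0 : 0 < P%:R :> R by rewrite ltr0n.
set z : R := nu%:R / P%:R; set r := Num.sqrt _.
have zE : nu%:R / (2 * P%:R) = z / 2 :> R by rewrite /z; field; rewrite gt_eqF.
have z0 : 0 <= z by rewrite divr_ge0.
have r0 : 0 <= r by rewrite sqrtr_ge0.
have r2 : 8 * r ^+ 2 * P%:R = nu1%:R.
  by rewrite sqr_sqrtr ?divr_ge0 ?mulr_ge0 //; field; rewrite gt_eqF.
have zP : nu%:R = z * P%:R by rewrite /z divfK // gt_eqF.
clearbody z r.
have W0 : 0 <= W%:R :> R by [].
have N0 : 0 <= N%:R :> R by [].
have n'0 : 0 <= n'%:R :> R by [].
have n'N' : n'%:R <= 2 * N%:R :> R by rewrite -natrM ler_nat.
have mu0 : 0 <= mu by apply: le_trans m0mu.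
have outs' : z * N%:R <= 2 * W%:R + 2 * z * (mu + 2 * W%:R).
  have : nu%:R * N%:R <= 2 * P%:R * W%:R + 2 * nu%:R * (m0%:R + 2 * W%:R) :> R.
    by rewrite -!natrM -natrD -!natrM -natrD ler_nat.
  rewrite zP => h.
  rewrite -(ler_pM2r p0); apply: le_trans (_ : 2 * P%:R * W%:R + 2 * (z * P%:R) * (m0%:R + 2 * W%:R) <= _).
    by rewrite (mulrAC z).
  have -> : (2 * W%:R + 2 * z * (mu + 2 * W%:R)) * P%:R =
      2 * P%:R * W%:R + 2 * (z * P%:R) * (mu + 2 * W%:R) by ring.
  by rewrite lerD2l ler_wpM2l ?lerD2r //; do !apply: mulr_ge0.
set y := r + _; set mn := Num.min _ _.
have mn4 : mn <= 1 / 4 by rewrite /mn ge_min lexx.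
have mny : mn <= y by rewrite /mn ge_min lexx orbT.
have y0 : 0 <= y by rewrite addr_ge0 // zE divr_ge0.
have mn0 : 0 <= mn by rewrite /mn le_min y0 andbT; lra.
have quarter : n'%:R * mn <= N%:R / 2.
  apply: le_trans (_ : 2 * N%:R * (1 / 4) <= _); last by lra.
  exact: ler_pM.
have [small|big] := leqP (2 * (m0 + 2 * W)) N; last first.
  have : N%:R <= 2 * (m0%:R + 2 * W%:R) :> R.
    by rewrite -natrM -natrD -natrM ler_nat ltnW.
  lra.
have [z4|z4] := leP (1 / 4) z.
  have [neg|pos] := leP (N%:R - 2 * mu - 4 * W%:R) 0; first by lra.
  have : 1 / 4 * (N%:R - 2 * mu - 4 * W%:R) <= z * (N%:R - 2 * mu - 4 * W%:R).
    by rewrite ler_wpM2r // ltW.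
  lra.
have zW : z * W%:R <= 1 / 4 * W%:R by rewrite ler_wpM2r // ltW.
have zmu : z * mu <= 1 / 4 * mu by rewrite ler_wpM2r // ltW.
have sums' : 2 * (N%:R * r) ^+ 2 <= W%:R * (mu + 2 * W%:R).
  have : nu1%:R * (N%:R * N%:R) <= 4 * P%:R * W%:R * (m0%:R + 2 * W%:R) :> R.
    by rewrite -!natrM -natrD -!natrM ler_nat; apply: sums.
  rewrite -r2 => h.
  have h2 : 4 * P%:R * W%:R * (m0%:R + 2 * W%:R) <= 4 * P%:R * W%:R * (mu + 2 * W%:R).
    by rewrite ler_wpM2l ?lerD2r //; do !apply: mulr_ge0.
  have p4 : 0 < 4 * P%:R :> R by rewrite mulr_gt0.
  rewrite -(ler_pM2l p4).
  rewrite (_ : 4 * P%:R * (2 * (N%:R * r) ^+ 2) = 8 * r ^+ 2 * P%:R * (N%:R * N%:R)); last by ring.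
  by apply: le_trans h _; rewrite [leRHS]mulrA.
(* After squaring, [2 * W * (mu + 2 * W)] is [(mu / 2 + 2 * W) ^ 2] without the term
   [mu ^ 2 / 4]. *)
have Nr : 2 * (N%:R * r) <= mu / 2 + 2 * W%:R.
  rewrite -(@ler_pXn2r _ 2) ?nnegrE ?mulr_ge0 //; last by lra.
  have := sqr_ge0 mu; have := mulr_ge0 mu0 W0; nra.
have ny : n'%:R * mn <= 2 * N%:R * y by apply: ler_pM.
have : 2 * N%:R * y = 2 * (N%:R * r) + z * N%:R by rewrite /y zE; field.
lra.
Qed.

Theorem theorem3 (R : realType) :
  exists c : R, 0 < c /\
  forall (s n P Bm : nat) (alpha : R) (f : instruction) (G : cdag n),
    (2 <= s)%N -> (0 < n)%N -> (0 < P)%N -> (0 < Bm)%N ->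
    1 <= alpha <= P%:R ->
    hybrid_algorithm s G f ->
    forall init : 'I_P -> {set ('I_n + 'I_n)},
      placement_bound alpha init ->
    forall es : seq (event G P),
      execution Bm init es ->
    exists p : 'I_P,
      c * ((msp_bound f n P alpha - alpha * n%:R / P%:R) / Bm%:R)
        <= (messages p es)%:R.
Proof.
exists (1 / 6); split; first by lra.
move=> s n P Bm alpha f G s2 n0 P0 Bm0 /andP[alpha1 _] [Hf wf [c Hc]] init place es [run_es all_es].
pose p0 : 'I_P := Ordinal P0.
(* The busiest processor witnesses the claim, so [W] bounds the words moved by any processor;
   [pinit] likewise gives an integer bound [m0] on the initial digits of A. *)
have [pmax _ Hpmax] := @arg_maxnP _ p0 xpredT (fun p => messages p es) isT.
have [pinit _ Hpinit] := @arg_maxnP _ p0 xpredT (fun p => #|[set i : 'I_n | inl i \in init p]|) isT.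
exists pmax; set mu := alpha * n%:R / P%:R.
set W := (Bm * messages pmax es)%N.
set m0 := #|[set i | inl i \in init pinit]| in Hpinit.
have m0mu : m0%:R <= mu by case: (place pinit).
have moved_le p : (#|moved p es| <= W)%N.
  by apply: leq_trans (card_moved p run_es) _; rewrite leq_mul2l; apply/orP; right; exact: Hpmax.
have all_computed g : exists p, computes p g es.
  have : has (fun e => if e is Compute _ g' then g' == g else false) es := all_es g.
  elim: es {run_es all_es Hpmax W moved_le} => //= e es IH /orP[|/IH[p cp]].
    by case: e => // q h /eqP->; exists q; rewrite /computes /= !eqxx.
  by exists p; rewrite /computes /= -/(computes p g es) cp orbT.
have Bm0' : 0 < Bm%:R :> R by rewrite ltr0n.
suff : msp_bound f n P alpha <= 6 * W%:R + mu.
  rewrite /W natrM => h.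
  have : (msp_bound f n P alpha - mu) / Bm%:R <= 6 * (messages pmax es)%:R.
    by rewrite ler_pdivrMr //; lra.
  lra.
(* The maximum in [msp_bound] starts from 0, so its upper bound must be non-negative. *)
have Wmu0 : 0 <= 6 * W%:R + mu.
  by apply: addr_ge0; [exact: mulr_ge0|apply: le_trans m0mu].
apply: bigmax_le => // n' _.
have [n'0|n'0] := posnP n'.
  by rewrite n'0 mul0r.
pose v0 : vertex G := inl (inl (Ordinal n0)).
have n20 : (0 < n.*2)%N by rewrite double_gt0.
pose g0 := tnth c (Ordinal n20).
(* For the whole problem [low_spec] is trivial, its inputs being A and B. *)
have [I [F [Fspec cardI stdI Fpacks]]] :=
  msp_family v0 n'0 Hf Hc (fun _ _ _ => conj erefl erefl).
have Nn : (uphalf n' <= n)%N by rewrite leq_uphalf_double -addnn (leq_trans _ (leq_addr _ _)) // -ltnS.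
rewrite -lerBlDr; apply: (@words_lower_bound R (uphalf n') n' P W m0) => //.
- by rewrite mul2n -leq_uphalf_double.
- exact: leq_addr.
- rewrite -cardI.
  exact: (output_words s2 wf run_es g0 Fspec Fpacks Nn all_computed moved_le (fun p => Hpinit p isT)).
- rewrite -stdI.
  exact: (summand_words s2 wf run_es Fspec Fpacks Nn all_computed moved_le (fun p => Hpinit p isT)).
Qed.
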